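(* Let $X$ be a weakly compactly generated (for instance, separable) real Banach space which is isomorphic to a closed subspace of $\ell_\infty$ and contains an isomorphic copy of $c_0$. Then there is an equivalent norm $p$ on $X$ such that for every two-dimensional linear subspace $Z$ of $(X,p)^*$, the set $Z\cap\operatorname{NA}((X,p),\mathbb{R})$ is contained in the union of two one-dimensional linear subspaces (that is, $S_Z\cap\operatorname{NA}((X,p),\mathbb{R})$ contains at most four points). Equivalently, given two linearly independent elements $f,g\in\operatorname{NA}((X,p),\mathbb{R})$, no element $tf+(1-t)g$ with $0<t<1$ belongs to $\operatorname{NA}((X,p),\mathbb{R})$.
   Context: All Banach spaces are real. For a Banach space $X$, $X^*$ is its topological dual with the dual norm and $S_X$ is its unit sphere; $S_Z$ denotes the unit sphere of the subspace $Z$ with the inherited norm. A functional $f\in X^*$ is norm-attaining if there is $x\in S_X$ with $|f(x)|=\|f\|$; $\operatorname{NA}(X,\mathbb{R})$ denotes the set of norm-attaining functionals on $X$. A Banach space is weakly compactly generated if it is the closed linear span of a weakly compact subset. ''Isomorphic'' means linearly homeomorphic. *)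

(* Defs.v *)
From HB Require Import structures.
From mathcomp Require Import all_boot all_order all_algebra.
From mathcomp Require Import all_classical all_reals all_analysis.

Set Implicit Arguments.
Unset Strict Implicit.
Unset Printing Implicit Defensive.

Import Order.TTheory GRing.Theory Num.Theory.
Import numFieldNormedType.Exports.

Local Open Scope classical_set_scope.
Local Open Scope ring_scope.

Section LinearAlgebra.
Context {R : realType} {V : lmodType R}.

Definition linear_subspace (A : set V) : Prop := submod_closed (mem A).

Definition linear_span (A : set V) : set V := smallest linear_subspace A.

Definition linearly_independent (n : nat) (e : n.-tuple V) : Prop :=
  forall c : 'I_n -> R,
    \sum_(i < n) c i *: tnth e i = 0 -> forall i, c i = 0.

Definition subspace_of_dim (n : nat) (Z : set V) : Prop :=
  exists2 e : n.-tuple V, linearly_independent e & Z = linear_span [set` e].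

End LinearAlgebra.

Definition unit_sphere {R : realType} {V : normedModType R} : set V :=
  [set x | `|x| = 1].

(** [A] and [B] are meant to be linear subspaces, each with the topology it
    inherits.  [T] and [S] are total functions whose values outside [A] and [B]
    are irrelevant. *)
Definition isomorphic {R : realType} {V W : normedModType R}
    (A : set V) (B : set W) : Prop :=
  exists T : V -> W, exists S : W -> V,
    [/\ set_fun A B T /\ set_fun B A S,
        {in A, cancel T S} /\ {in B, cancel S T},
        (forall a : R, {in A &, forall x y, T (a *: x + y) = a *: T x + T y}),
        {within A, continuous T} & {within B, continuous S}].

Section Dual.
Context {R : realType} (V : normedModType R).

Definition continuous_linear : {pred V -> R^o} :=
  [pred f : V -> R^o | `[< linear f /\ continuous f >]].

Lemma continuous_linear_submod_closed : submod_closed continuous_linear.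
Proof.
split.
  apply/asboolP; split; first by move=> a x y; rewrite /= scaler0 addr0.
  by move=> x; exact: cvg_cst.
move=> a f g /asboolP[lf cf] /asboolP[lg cg]; apply/asboolP; split.
  move=> b x y; have -> z : (a *: f + g) z = a *: f z + g z by [].
  by rewrite lf lg !scalerDr !scalerA (mulrC b) addrACA.
move=> x; apply: (@cvgD _ _ _ _ _ (fun y => a *: f y) g); last exact: cg.
by apply: cvgZl_tmp; exact: cf.
Qed.

HB.instance Definition _ := GRing.isSubmodClosed.Build R (V -> R^o)
  continuous_linear continuous_linear_submod_closed.

Record dual := Dual {
  dual_fun :> V -> R^o;
  dual_funP : dual_fun \in continuous_linear }.

HB.instance Definition _ := [isSub for dual_fun].
HB.instance Definition _ := [Choice of dual by <:].
HB.instance Definition _ := [SubChoice_isSubLmodule of dual by <:].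

Definition dual_norm (f : dual) : R :=
  sup [set `|f x| | x in [set x : V | `|x| <= 1]].

Lemma dual_linear (f : dual) : linear f.
Proof. by have /asboolP[] := dual_funP f. Qed.

Lemma dual_continuous (f : dual) : continuous f.
Proof. by have /asboolP[] := dual_funP f. Qed.

Lemma dual0 (f : dual) : f 0 = 0.
Proof.
have := dual_linear f (-1) 0 0; rewrite scaler0 addr0.
by rewrite [X in _ = X + _]scaleN1r addNr.
Qed.

Lemma dualZ (f : dual) a x : f (a *: x) = a * f x.
Proof. by have := dual_linear f a x 0; rewrite dual0 !addr0. Qed.

Lemma dual_has_sup (f : dual) :
  has_sup [set `|f x| | x in [set x : V | `|x| <= 1]].
Proof.
split; first by exists `|f 0|; exists 0 => //=; rewrite normr0.
pose L := GRing.isLinear.Build R V R^o *:%R f (dual_linear f).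
pose g : {linear V -> R^o} := HB.pack (f : V -> R^o) L.
have /linear_boundedP : bounded_near g (nbhs 0).
  by apply/linear_bounded_continuous; exact: dual_continuous.
move=> /pinfty_ex_gt0[r r0 fr]; exists r => _ [x /= x1 <-].
by rewrite (le_trans (fr x))// ler_piMr// ltW.
Qed.

Lemma dual_norm_ub (f : dual) x : `|x| <= 1 -> `|f x| <= dual_norm f.
Proof. by move=> x1; apply: sup_upper_bound; [exact: dual_has_sup|exists x]. Qed.

Lemma dual_norm_le (f : dual) r :
  (forall x, `|x| <= 1 -> `|f x| <= r) -> dual_norm f <= r.
Proof.
move=> fr; apply: ge_sup; first by have [] := dual_has_sup f.
by move=> _ [x /= x1 <-]; exact: fr.
Qed.

Lemma dual_normD f g : dual_norm (f + g) <= dual_norm f + dual_norm g.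
Proof.
apply: dual_norm_le => x x1.
by rewrite (le_trans (ler_normD _ _))// lerD// dual_norm_ub.
Qed.

Lemma dual_normZ (a : R) f : dual_norm (a *: f) = `|a| * dual_norm f.
Proof.
have leZ b h : dual_norm (b *: h) <= `|b| * dual_norm h.
  apply: dual_norm_le => x x1.
  by rewrite [leLHS]normrM ler_wpM2l// dual_norm_ub.
apply/eqP; rewrite eq_le leZ/=; have [->|a0] := eqVneq a 0.
  rewrite normr0 mul0r (le_trans (normr_ge0 _) (dual_norm_ub _ (x := 0) _))//.
  by rewrite normr0.
rewrite -ler_pdivlMl ?normr_gt0// -normfV.
by have := leZ a^-1 (a *: f); rewrite scalerA mulVf// scale1r.
Qed.

Lemma dual_norm0_eq0 f : dual_norm f = 0 -> f = 0.
Proof.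
move=> f0; apply/val_inj/funext => x /=.
have [->|x0] := eqVneq x 0; first exact: dual0.
have nx0 : `|x| != 0 by rewrite normr_eq0.
have : `|f (`|x|^-1 *: x)| <= dual_norm f.
  by apply: dual_norm_ub; rewrite normrZ normfV normr_id mulVf.
rewrite f0 normr_le0 dualZ mulf_eq0 invr_eq0 (negbTE nx0)/=.
by move/eqP.
Qed.

HB.instance Definition _ :=
  Lmodule_isNormed.Build R dual dual_normD dual_normZ dual_norm0_eq0.

Definition norm_attaining : set dual :=
  [set f : dual | exists2 x : V, unit_sphere x & `|f x| = `|f|].

Definition weak_topology : Type :=
  sup_topology (fun f : dual =>
    Topological.class (initial_topology (f : V -> R^o))).

HB.instance Definition _ := Topological.on weak_topology.

Definition weakly_compact (K : set V) : Prop := compact (K : set weak_topology).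

Definition weakly_compactly_generated : Prop :=
  exists2 K : set V, weakly_compact K & closure (linear_span K) = [set: V].

End Dual.

Arguments norm_attaining {R} V.
Arguments weak_topology {R} V.
Arguments weakly_compactly_generated {R} V.

Section SequenceSpaces.
Context (R : realType).

Definition bounded_sequence : {pred nat -> R^o} :=
  [pred u : nat -> R^o | `[< bounded_fun u >]].

Lemma bounded_sequence_submod_closed : submod_closed bounded_sequence.
Proof.
split.
  by apply/asboolP; exact: bounded_cst.
move=> a u v /asboolP bu /asboolP bv; apply/asboolP.
apply: bounded_funD => //.
case: bu => M [Mr Mu]; exists (`|a| * (`|M| + 1)).
split=> [|x /ltW ax n _ /=]; first exact: num_real.
rewrite (le_trans _ ax)// [leLHS]normrM ler_wpM2l//; apply: Mu => //.
by rewrite (le_lt_trans (ler_norm _))// ltrDl.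
Qed.

HB.instance Definition _ := GRing.isSubmodClosed.Build R (nat -> R^o)
  bounded_sequence bounded_sequence_submod_closed.

Record ell_infty := EllInfty {
  ell_infty_fun :> nat -> R^o;
  ell_inftyP : ell_infty_fun \in bounded_sequence }.

HB.instance Definition _ := [isSub for ell_infty_fun].
HB.instance Definition _ := [Choice of ell_infty by <:].
HB.instance Definition _ := [SubChoice_isSubLmodule of ell_infty by <:].

Definition ell_infty_norm (u : ell_infty) : R := sup (range (fun n => `|u n|)).

Lemma ell_infty_norm_ub (u : ell_infty) n : `|u n| <= ell_infty_norm u.
Proof.
apply: sup_upper_bound; last by exists n.
split; first by exists `|u 0%N|; exists 0%N.
have /asboolP[M [Mr Mu]] := ell_inftyP u.
exists (`|M| + 1) => _ [m _ <-]; apply: Mu => //.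
by rewrite (le_lt_trans (ler_norm _))// ltrDl.
Qed.

Lemma ell_infty_norm_le (u : ell_infty) r :
  (forall n, `|u n| <= r) -> ell_infty_norm u <= r.
Proof.
move=> ur; apply: ge_sup; first by exists `|u 0%N|; exists 0%N.
by move=> _ [n _ <-].
Qed.

Lemma ell_infty_normD u v :
  ell_infty_norm (u + v) <= ell_infty_norm u + ell_infty_norm v.
Proof.
apply: ell_infty_norm_le => n.
by rewrite (le_trans (ler_normD _ _))// lerD// ell_infty_norm_ub.
Qed.

Lemma ell_infty_normZ (a : R) u :
  ell_infty_norm (a *: u) = `|a| * ell_infty_norm u.
Proof.
have leZ b v : ell_infty_norm (b *: v) <= `|b| * ell_infty_norm v.
  apply: ell_infty_norm_le => n.
  by rewrite [leLHS]normrM ler_wpM2l// ell_infty_norm_ub.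
apply/eqP; rewrite eq_le leZ/=; have [->|a0] := eqVneq a 0.
  by rewrite normr0 mul0r (le_trans (normr_ge0 _) (ell_infty_norm_ub _ 0%N)).
rewrite -ler_pdivlMl ?normr_gt0// -normfV.
by have := leZ a^-1 (a *: u); rewrite scalerA mulVf// scale1r.
Qed.

Lemma ell_infty_norm0_eq0 u : ell_infty_norm u = 0 -> u = 0.
Proof.
move=> u0; apply/val_inj/funext => n /=.
by apply/eqP; rewrite -normr_le0 -u0 ell_infty_norm_ub.
Qed.

HB.instance Definition _ := Lmodule_isNormed.Build R ell_infty
  ell_infty_normD ell_infty_normZ ell_infty_norm0_eq0.

Definition c0 : set ell_infty := [set u | u n @[n --> \oo] --> (0 : R^o)].

End SequenceSpaces.

Arguments c0 : clear implicits.

Record norm_on {R : realType} (V : lmodType R) := NormOn {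
  norm_on_fun :> V -> R;
  norm_onD : forall x y, norm_on_fun (x + y) <= norm_on_fun x + norm_on_fun y;
  norm_onZ : forall (a : R) x, norm_on_fun (a *: x) = `|a| * norm_on_fun x;
  norm_on0_eq0 : forall x, norm_on_fun x = 0 -> x = 0 }.

Definition equivalent_norm {R : realType} {V : normedModType R}
    (p : norm_on V) : Prop :=
  exists c C : R, [/\ 0 < c, 0 < C & forall x, c * `|x| <= p x <= C * `|x|].

(** An alias of [V] on which `|x| and the topology are those of [p], also when
    [V] already carries another norm. *)
Definition renormed {R : realType} {V : lmodType R} (p : norm_on V) : Type := V.

HB.instance Definition _ (R : realType) (V : lmodType R) (p : norm_on V) :=
  GRing.Lmodule.on (renormed p).

HB.instance Definition _ (R : realType) (V : lmodType R) (p : norm_on V) :=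
  Lmodule_isNormed.Build R (renormed p)
    (@norm_onD R V p) (@norm_onZ R V p) (@norm_on0_eq0 R V p).

(* Main.v *)
(** Let [e_n] be the basis of the copy of c_0, [psi_n] Hahn-Banach extensions of
    the coordinate functionals (so [|psi_n| <= K]), and
    [mu x = max (sup_n |psi_n x|, 2 K dist (x, c_0))].  Since
    [limsup_n |psi_n x| <= K dist (x, c_0) <= mu x / 2], small multiples of
    [e_n] with [n] large can be added to [x] without increasing [mu], so every
    functional attaining its [mu]-norm vanishes on [e_n] for large [n].

    A weakly compact set whose points are separated by countably many
    functionals is weakly separable, hence there is a total sequence [d] in [X].
    The infimal convolution [q^2 x = inf_z (mu (x - T z)^2 + |z|^2)], with [T]
    sending the i-th basis vector of l_2 to a multiple of [d_i], is smooth;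
    for a minimizing sequence the points [x - T z] converge, and [q] inherits at
    [x] the property that [mu] has at the limit.

    Let [u_n] be a bounded sequence of functionals that repeatedly takes all
    directions in the rational span of the coordinates of l_infty, and let
    [a_n = 4^-n (u_n + 2^-n psi_(A n))] with [A] growing fast enough.  The norm
    is [p x = sum_n sqrt (a_n(x)^2 + 64^-n q(x)^2)].  It is smooth, and its
    gradient at [x] agrees on [e_m], for large [m], with [sum_n c_n(x) a_n],
    where [|c_n(x)| <= 1] and [c_n(x)] is close to [+-1] whenever [u_n(x)] stays
    away from 0.  A relation [s3 f3 = s1 f1 + s2 f2] with [s_i > 0] between
    gradients at [x1], [x2], [x3] can be tested on [e_(A n)] and yields
    [s3 c_n(x3) - s1 c_n(x1) - s2 c_n(x2) --> 0].  If [x1], [x2] are linearly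
    independent, infinitely many [u_n] have the same sign at [x1] and [x2], which
    forces [s3 >= s1 + s2], and infinitely many have opposite signs, which forces
    [s3 = |s1 - s2|].  So [x1] and [x2] are proportional, and then so are [f1]
    and [f2] by smoothness. *)

From HB Require Import structures.
From mathcomp Require Import all_boot all_order all_algebra.
From mathcomp Require Import all_classical all_reals all_analysis.
From mathcomp Require Import ring lra.
Require Import Defs.

Set Implicit Arguments.
Unset Strict Implicit.
Unset Printing Implicit Defensive.

Import Order.TTheory GRing.Theory Num.Theory.
Import numFieldNormedType.Exports.

Local Open Scope classical_set_scope.
Local Open Scope ring_scope.
Local Open Scope card_scope.

(** * Hahn-Banach theorem *)

Section Infimum.
Context {R : realType} {T : Type}.
Implicit Types (A : set T) (F : T -> R) (m e : R).

Lemma inf_image_le A F m t :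
  (forall s, A s -> m <= F s) -> A t -> inf (F @` A) <= F t.
Proof.
move=> mF At; apply: ge_inf; last by exists t.
by exists m => _ [s As <-]; exact: mF.
Qed.

Lemma le_inf_image A F m :
  A !=set0 -> (forall s, A s -> m <= F s) -> m <= inf (F @` A).
Proof.
move=> [t At] mF; apply: lb_le_inf; first by exists (F t), t.
by move=> _ [s As <-]; exact: mF.
Qed.

Lemma inf_image_lt A F m e : A !=set0 -> (forall s, A s -> m <= F s) ->
  0 < e -> exists2 t, A t & F t < inf (F @` A) + e.
Proof.
move=> [t At] mF e0; have [|_ [s As <-] sF] := @inf_adherent _ (F @` A) _ e0.
  split; first by exists (F t), t.
  by exists m => _ [s As <-]; exact: mF.
by exists s.
Qed.

End Infimum.

Section HahnBanach.
Context {R : realType} {V : lmodType R}.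

(** The inequality in the second clause is equivalent to equality: apply it to [a^-1] and
    [a *: x]. *)
Definition sublinear (p : V -> R) :=
  (forall x y, p (x + y) <= p x + p y) /\
  (forall a x, 0 < a -> p (a *: x) <= a * p x).

Lemma sublinearN_ge p x : sublinear p -> - p (- x) <= p x.
Proof.
move=> [pD pZ]; have := pD 0 0; rewrite addr0.
by have := pD x (- x); rewrite subrr; lra.
Qed.

(** Near-minimizers chosen at [x] and at [y] are comparable, so the smaller of them is nearly
    optimal at both points, and its subadditivity passes to the infimum. *)
Lemma sublinear_chain_inf (p0 : V -> R) (A : set (V -> R)) : A !=set0 ->
  (forall p, A p -> sublinear p /\ forall x, p x <= p0 x) ->
  (forall p1 p2, A p1 -> A p2 -> (forall x, p1 x <= p2 x) \/
     (forall x, p2 x <= p1 x)) ->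
  sublinear (fun x => inf ((fun p => p x) @` A)).
Proof.
move=> A0 Ap Achain.
have lbA x p : A p -> - p0 (- x) <= p x.
  move=> /Ap[sp pp0]; have := sublinearN_ge x sp; have := pp0 (- x); lra.
split=> [x y|a x a0].
  apply/ler_addgt0Pr => e e0.
  have e2 : 0 < e / 2 by lra.
  have [p1 A1 p1x] := inf_image_lt A0 (lbA x) e2.
  have [p2 A2 p2y] := inf_image_lt A0 (lbA y) e2.
  have [p [/[dup] /Ap[[pD _] _] Ap' pp1 pp2]] :
      exists p, [/\ A p, forall x, p x <= p1 x & forall x, p x <= p2 x].
    by case: (Achain _ _ A1 A2) => ?; [exists p1|exists p2].
  apply: le_trans (inf_image_le (lbA _) Ap') _.
  by have := pD x y; have := pp1 x; have := pp2 y; lra.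
rewrite -ler_pdivrMl//; apply: le_inf_image => // p Ap'.
rewrite ler_pdivrMl//; apply: le_trans (inf_image_le (lbA _) Ap') _.
by have [[_ +] _] := Ap _ Ap'; apply.
Qed.

(** The choices [t = 0] and [t = 1] give the two bounds. The second one, read for a minimal [p], is
    the reverse of subadditivity. *)
Lemma sublinear_shift_inf (p : V -> R) (y : V) : sublinear p ->
  let r x := inf ((fun t => p (x + t *: y) - t * p y) @` [set t | 0 <= t]) in
  [/\ sublinear r, forall x, r x <= p x & forall x, r x <= p (x + y) - p y].
Proof.
move=> sp r; have [pD pZ] := sp.
have A0 : [set t : R | 0 <= t] !=set0 by exists 0 => /=.
(* The infimum is finite because [t *: y] is the sum of [- x] and [x + t *: y]. *)
have lbr x t : 0 <= t -> - p (- x) <= p (x + t *: y) - t * p y.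
  have p0 : 0 <= p 0 by have := pD 0 0; rewrite addr0; lra.
  rewrite le_eqVlt => /predU1P[<-|t0].
    by rewrite scale0r addr0 mul0r subr0; exact: sublinearN_ge.
  have := pD (- x) (x + t *: y); rewrite addKr.
  have := pZ t^-1 (t *: y); rewrite invr_gt0 => /(_ t0).
  rewrite scalerA mulVf ?gt_eqF// scale1r ler_pdivlMl//; lra.
have rle x t : 0 <= t -> r x <= p (x + t *: y) - t * p y.
  by move=> t0; apply: (inf_image_le (lbr x)).
split.
- split=> [x1 x2|a x a0].
    apply/ler_addgt0Pr => e e0; have e2 : 0 < e / 2 by lra.
    have [t1 /= t10 ht1] := inf_image_lt A0 (lbr x1) e2.
    have [t2 /= t20 ht2] := inf_image_lt A0 (lbr x2) e2.
    have := rle (x1 + x2) (t1 + t2) (addr_ge0 t10 t20).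
    have := pD (x1 + t1 *: y) (x2 + t2 *: y).
    rewrite addrACA -scalerDl; rewrite -/(r x1) -/(r x2) in ht1 ht2 *; lra.
  rewrite -ler_pdivrMl//; apply: le_inf_image => // t /= t0.
  rewrite ler_pdivrMl//.
  have := rle (a *: x) (a * t) (mulr_ge0 (ltW a0) t0).
  have := pZ a (x + t *: y) a0; rewrite scalerDr scalerA mulrBr mulrA; lra.
- by move=> x; have := rle x 0 (lexx _); rewrite scale0r addr0 mul0r subr0.
- by move=> x; have := rle x 1 ler01; rewrite scale1r mul1r.
Qed.

Lemma sublinear_minimal_scalar (p : V -> R) : sublinear p ->
  (forall r, sublinear r -> (forall x, r x <= p x) -> r = p) -> scalar p.
Proof.
move=> sp pmin; have [pD pZ] := sp.
have padd x y : p (x + y) = p x + p y.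
  have [sr rp rs] := sublinear_shift_inf y sp.
  have E := pmin _ sr rp; have := rs x.
  by rewrite [leLHS](congr1 (@^~ x) E); have := pD x y; lra.
have p0 : p 0 = 0 by have := padd 0 0; rewrite addr0; lra.
have pN x : p (- x) = - p x by have := padd x (- x); rewrite subrr; lra.
have ppos a x : 0 < a -> p (a *: x) = a * p x.
  move=> a0; apply/eqP; rewrite eq_le pZ//=.
  have := pZ a^-1 (a *: x); rewrite invr_gt0 => /(_ a0).
  by rewrite scalerA mulVf ?gt_eqF// scale1r ler_pdivlMl.
move=> a x y; rewrite padd; congr (_ + _).
have [a0|a0|<-] := ltgtP 0 a; first exact: ppos.
- by rewrite -[a]opprK scaleNr pN ppos ?oppr_gt0// !mulNr.
- by rewrite scale0r mul0r.
Qed.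

(* A minimal sublinear functional is linear: otherwise
   inf_(t >= 0) (p (x + t y) - t p(y)) would be a smaller one. *)
Theorem hahn_banach (p : V -> R) : sublinear p ->
  exists g : {scalar V}, forall x, g x <= p x.
Proof.
move=> sp.
pose T := {q : V -> R | sublinear q /\ forall x, q x <= p x}.
pose mkT q (sq : sublinear q) (qp : forall x, q x <= p x) : T :=
  exist (fun q => sublinear q /\ forall x, q x <= p x) q (conj sq qp).
(* The order is reversed, so that a maximal element in Zorn's lemma is a minimal sublinear
   functional. *)
pose le_T (s t : T) := `[< forall x, sval t x <= sval s x >].
have [|r s t /asboolP rs /asboolP st|s t /asboolP st /asboolP ts|A Atot|m mmin]
    := @Zorn T le_T.
- by move=> t; apply/asboolP.
- by apply/asboolP => x; exact: le_trans (st x) (rs x).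
- apply: eq_sig_hprop => [q|]; first exact: Prop_irrelevance.
  by apply/funext => x; apply/eqP; rewrite eq_le st ts.
- have [[t0 At0]|A0] := pselect (A !=set0); last first.
    exists (mkT p sp (fun x => lexx _)) => s As.
    by exfalso; apply: A0; exists s.
  pose B := [set sval t | t in A].
  have B0 : B !=set0 by exists (sval t0), t0.
  have Bp q : B q -> sublinear q /\ forall x, q x <= p x.
    by move=> [t _ <-]; exact: svalP t.
  have lbB x q : B q -> - p (- x) <= q x.
    move=> /Bp[sq qp]; have := sublinearN_ge x sq; have := qp (- x); lra.
  have sB := sublinear_chain_inf B0 Bp.
  have {}sB : sublinear (fun x => inf ((fun q => q x) @` B)).
    apply: sB => _ _ [s As <-] [t At <-].
    by case: (Atot _ _ As At) => /asboolP; [right|left].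
  have Bl x t : A t -> inf ((fun q => q x) @` B) <= sval t x.
    by move=> At; apply: (inf_image_le (lbB x)); exists t.
  have Bl0 x : inf ((fun q => q x) @` B) <= p x.
    by apply: le_trans (Bl x _ At0) _; have [_] := svalP t0.
  exists (mkT _ sB Bl0) => s As; apply/asboolP => x /=.
  exact: Bl.
have [sm mp] := svalP m.
have sc : scalar (sval m).
  apply: sublinear_minimal_scalar => // r sr rm.
  have rp x : r x <= p x := le_trans (rm x) (mp x).
  have := mmin (mkT r sr rp).
  by rewrite /le_T asboolE => /(_ rm) <-.
pose L := GRing.isLinear.Build R V R *%R (sval m) sc.
by exists (HB.pack (sval m) L : {scalar V}).
Qed.

(** The sublinear functional [inf_(y in Y) (psi y + N (x - y))] is at most [N] everywhere and at
    most [psi] on [Y]. A linear functional below it equals [psi] on [Y], as is seen by testing [y]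
    and [- y]. *)
Lemma hahn_banach_extension (Y : set V)
    (psi : V -> R) (N : V -> R) :
  Y 0 -> (forall a x y, Y x -> Y y -> Y (a *: x + y)) ->
  (forall a x y, Y x -> Y y -> psi (a *: x + y) = a * psi x + psi y) ->
  (forall x y, N (x + y) <= N x + N y) ->
  (forall a x, N (a *: x) = `|a| * N x) ->
  (forall y, Y y -> `|psi y| <= N y) ->
  exists2 g : {scalar V}, (forall y, Y y -> g y = psi y) &
    forall x, `|g x| <= N x.
Proof.
move=> Y0 YL psiL ND NZ psiN.
have N0 : N 0 = 0 by rewrite -(scale0r 0) NZ normr0 mul0r.
have NN x : N (- x) = N x by rewrite -scaleN1r NZ normrN1 mul1r.
have psiD x y : Y x -> Y y -> psi (x + y) = psi x + psi y.
  by move=> Yx Yy; rewrite -[x]scale1r psiL// mul1r scale1r.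
have YD x y : Y x -> Y y -> Y (x + y).
  by move=> Yx Yy; rewrite -[x]scale1r; exact: YL.
have psi0 : psi 0 = 0 by have := psiD 0 0 Y0 Y0; rewrite addr0; lra.
have psiZ a x : Y x -> psi (a *: x) = a * psi x.
  by move=> Yx; rewrite -[a *: x]addr0 psiL// psi0 addr0.
have YZ a x : Y x -> Y (a *: x).
  by move=> Yx; rewrite -[a *: x]addr0; exact: YL.
pose p x := inf ((fun y => psi y + N (x - y)) @` Y).
have Yn0 : Y !=set0 by exists 0.
have lbp x y : Y y -> - N x <= psi y + N (x - y).
  move=> Yy; have := psiN y Yy; have := ND (x - y) (- x).
  by rewrite addrAC subrr add0r !NN ler_norml => ? /andP[]; lra.
have ple x y : Y y -> p x <= psi y + N (x - y).
  by move=> Yy; exact: (inf_image_le (lbp x)).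
have sp : sublinear p.
  split=> [x y|a x a0].
    apply/ler_addgt0Pr => e e0; have e2 : 0 < e / 2 by lra.
    have [y1 Y1 h1] := inf_image_lt Yn0 (lbp x) e2.
    have [y2 Y2 h2] := inf_image_lt Yn0 (lbp y) e2.
    have := ple (x + y) _ (YD _ _ Y1 Y2); rewrite psiD//.
    have := ND (x - y1) (y - y2); rewrite addrACA -opprD.
    rewrite -/(p x) -/(p y) in h1 h2 *; lra.
  rewrite -ler_pdivrMl//; apply: le_inf_image => // y Yy.
  rewrite ler_pdivrMl//; apply: le_trans (ple _ _ (YZ a _ Yy)) _.
  by rewrite psiZ// -scalerBr NZ gtr0_norm// mulrDr.
have [g gp] := hahn_banach sp.
have gN x : g x <= N x.
  by apply: le_trans (gp x) _; have := ple x 0 Y0; rewrite psi0 add0r subr0.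
have gY y : Y y -> g y <= psi y.
  move=> Yy; apply: le_trans (gp y) _.
  by have := ple y y Yy; rewrite subrr N0 addr0.
exists g => [y Yy|x]; last first.
  by have := gN x; have := gN (- x); rewrite raddfN NN ler_norml; lra.
have := gY _ (YZ (-1) _ Yy); rewrite scaleN1r raddfN -scaleN1r psiZ//.
have := gY _ Yy => h1 h2; apply/eqP; rewrite eq_le h1/=; lra.
Qed.

End HahnBanach.

(** * Renorming around a copy of c_0 *)

Section BoundedOperators.
Context {R : realType}.

Lemma linear_subspaceP {V : lmodType R} (A : set V) : linear_subspace A ->
  A 0 /\ forall a x y, A x -> A y -> A (a *: x + y).
Proof.
move=> [A0 AL]; split; first by have := A0; rewrite inE.
by move=> a x y Ax Ay; have := AL a x y; rewrite !inE; apply.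
Qed.

Lemma within_continuous_linear_bounded {V W : normedModType R} (A : set V)
    (T : V -> W) : A 0 -> (forall a x y, A x -> A y -> A (a *: x + y)) ->
  (forall a x y, A x -> A y -> T (a *: x + y) = a *: T x + T y) ->
  {within A, continuous T} ->
  exists2 B, 0 < B & forall x, A x -> `|T x| <= B * `|x|.
Proof.
move=> A0 AL TL /subspace_continuousP /(_ 0 A0) /cvgrPdist_lt /(_ 1 ltr01).
have T0 : T 0 = 0.
  by have := TL (-1) 0 0 A0 A0; rewrite !scaleN1r !addNr.
have TZ a x : A x -> T (a *: x) = a *: T x.
  by move=> Ax; have := TL a x 0 Ax A0; rewrite T0 !addr0.
have AZ a x : A x -> A (a *: x).
  by move=> Ax; have := AL a x 0 Ax A0; rewrite addr0.
rewrite near_withinE => /nbhs_norm0P[d /= d0 Td].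
exists (2 / d); first by rewrite divr_gt0.
move=> x Ax; have [->|x0] := eqVneq x 0; first by rewrite T0 !normr0 mulr0.
have nx0 : 0 < `|x| by rewrite normr_gt0.
(* This rescales [x] to norm [d / 2], inside the ball where continuity at 0 bounds [T] by 1. *)
pose a := d / (2 * `|x|).
have a0 : 0 < a by rewrite divr_gt0 ?mulr_gt0.
have := Td (a *: x); rewrite /= /from_subspace normrZ (gtr0_norm a0) T0 add0r normrN.
have -> : a * `|x| = d / 2 by rewrite /a; field; rewrite gt_eqF.
move=> /(_ ltac:(lra) (AZ _ _ Ax)); rewrite TZ// normrZ (gtr0_norm a0).
rewrite -ltr_pdivlMl// mulr1 => /ltW /le_trans; apply.
by rewrite /a invf_div mulrAC.
Qed.

End BoundedOperators.

Section C0.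
Context (R : realType).

Lemma ell_infty_unit_subproof (n : nat) :
  ((fun m : nat => (m == n)%:R) : nat -> R^o) \in @bounded_sequence R.
Proof.
apply/asboolP; exists 1; split=> // x x1 m _ /=.
by apply: ltW; apply: le_lt_trans x1; case: eqP; rewrite ?normr1 ?normr0.
Qed.

Definition ell_infty_unit n := EllInfty (ell_infty_unit_subproof n).

Lemma c0_0 : c0 R 0. Proof. exact: cvg_cst. Qed.

Lemma c0_linear a u v : c0 R u -> c0 R v -> c0 R (a *: u + v).
Proof.
move=> u0 v0; rewrite /c0/= -[X in _ --> X](addr0 (0 : R^o)).
apply: (@cvgD _ _ _ _ _ (fun n => a * u n) v) => //.
by rewrite -[X in _ --> X](mulr0 a); apply: cvgMr.
Qed.

Lemma c0_unit n : c0 R (ell_infty_unit n).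
Proof.
apply/cvgrPdist_lt => e e0; exists n.+1 => // m /= nm.
by rewrite gtn_eqF// subr0 normr0.
Qed.

End C0.

Section Supremum.
Context {R : realType} {T : Type}.
Implicit Types (F : T -> R) (m : R).

Lemma le_sup_range F m t : (forall s, F s <= m) -> F t <= sup (range F).
Proof.
move=> Fm; apply: ub_le_sup; last by exists t.
by exists m => _ [s _ <-].
Qed.

Lemma sup_range_le F m (t : T) : (forall s, F s <= m) -> sup (range F) <= m.
Proof. by move=> Fm; apply: ge_sup; [exists (F t), t|move=> _ [s _ <-]]. Qed.

End Supremum.

Section C0Norm.
Context {R : realType} {X : normedModType R}.
(** [Y] is the copy of c_0, [e] its basis, and [psi] extends the coordinate functionals to [X].
    Hypothesis [Y_le] says that the isomorphism from c_0 onto [Y] is bounded by [L]. *)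
Context (Y : set X) (e : nat -> X) (psi : nat -> {scalar X}) (K L : R).
Context (K_gt0 : 0 < K) (L_gt0 : 0 < L)
  (psi_le : forall n x, `|psi n x| <= K * `|x|)
  (psie : forall n m, psi n (e m) = (n == m)%:R)
  (Y0 : Y 0) (YL : forall a x y, Y x -> Y y -> Y (a *: x + y))
  (Ye : forall n, Y (e n))
  (psi_cvg0 : forall y, Y y -> psi n y @[n --> \oo] --> (0 : R))
  (Y_le : forall y r, Y y -> (forall n, `|psi n y| <= r) -> `|y| <= L * r).

Let dist x := inf ((fun y => `|x - y|) @` Y).
Let coord x := sup (range (fun n => `|psi n x|)).
Let mu x := Num.max (coord x) (2 * K * dist x).

Let Yn0 : Y !=set0. Proof. by exists 0. Qed.

Let dist_le x y : Y y -> dist x <= `|x - y|.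
Proof. by apply: inf_image_le => z _; exact: normr_ge0. Qed.

Let dist_ge0 x : 0 <= dist x.
Proof. by apply: le_inf_image => // y _; exact: normr_ge0. Qed.

Let dist_lt x eps : 0 < eps -> exists2 y, Y y & `|x - y| < dist x + eps.
Proof. by move=> e0; apply: (@inf_image_lt _ _ _ _ 0) => // y _. Qed.

Let coord_ge x n : `|psi n x| <= coord x.
Proof. exact: (le_sup_range (F := fun n => `|psi n x|) n (fun n => psi_le n x)). Qed.

Let coord_le x r : (forall n, `|psi n x| <= r) -> coord x <= r.
Proof. exact: (sup_range_le 0%N). Qed.

Let mu_le x r : (forall n, `|psi n x| <= r) -> 2 * K * dist x <= r -> mu x <= r.
Proof. by move=> xr dr; rewrite /mu ge_max coord_le. Qed.

Let psi_mu x n : `|psi n x| <= mu x.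
Proof. by rewrite /mu le_max coord_ge. Qed.

Let dist_mu x : 2 * K * dist x <= mu x.
Proof. by rewrite /mu le_max lexx orbT. Qed.

Let YD x y : Y x -> Y y -> Y (x + y).
Proof. by move=> Yx Yy; rewrite -[x]scale1r; exact: YL. Qed.

Let YZ a x : Y x -> Y (a *: x).
Proof. by move=> Yx; rewrite -[a *: x]addr0; exact: YL. Qed.

Let distD x y : dist (x + y) <= dist x + dist y.
Proof.
apply/ler_addgt0Pr => eps e0; have e2 : 0 < eps / 2 by lra.
have [u Yu hu] := dist_lt x e2; have [v Yv hv] := dist_lt y e2.
have := dist_le (x + y) (YD Yu Yv).
have := ler_normD (x - u) (y - v); rewrite addrACA -opprD; lra.
Qed.

Let distZ_le a x : dist (a *: x) <= `|a| * dist x.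
Proof.
have [->|a0] := eqVneq a 0.
  by rewrite scale0r normr0 mul0r (le_trans (dist_le 0 Y0))// subrr normr0.
have na0 : 0 < `|a| by rewrite normr_gt0.
rewrite -ler_pdivrMl//; apply: le_inf_image => // y Yy; rewrite ler_pdivrMl//.
by rewrite -normrZ scalerBr; apply: dist_le; exact: YZ.
Qed.

Let muD x y : mu (x + y) <= mu x + mu y.
Proof.
apply: mu_le => [n|].
  rewrite raddfD; apply: le_trans (ler_normD _ _) _.
  by apply: lerD; exact: psi_mu.
have := distD x y; have := dist_mu x; have := dist_mu y.
by move=> ? ? /(ler_wpM2l (ltW (mulr_gt0 (ltr0Sn _ 1) K_gt0))); lra.
Qed.

Let muZ_le a x : mu (a *: x) <= `|a| * mu x.
Proof.
apply: mu_le => [n|].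
  by rewrite linearZ/= normrM; apply: ler_wpM2l => //; exact: psi_mu.
rewrite (le_trans (ler_wpM2l _ (distZ_le a x)))//.
  by rewrite mulr_ge0// ltW.
by rewrite mulrCA ler_wpM2l.
Qed.

Let muZ a x : mu (a *: x) = `|a| * mu x.
Proof.
apply/eqP; rewrite eq_le muZ_le/=; have [->|a0] := eqVneq a 0.
  by rewrite normr0 mul0r (le_trans (normr_ge0 _) (psi_mu _ 0%N)).
rewrite -ler_pdivlMl ?normr_gt0// -normfV.
by have := muZ_le a^-1 (a *: x); rewrite scalerA mulVf// scale1r.
Qed.

(** For [y] in [Y] the coordinates of [y] are at most [mu x + K * |x - y|], so [Y_le] controls [y],
    hence [x]. Taking the infimum over [y] replaces [|x - y|] by [dist x], which is at most
    [mu x / (2 * K)]. *)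
Let mu_lower x : `|x| <= ((1 + L * K) / (2 * K) + L) * mu x.
Proof.
have H y : Y y -> `|x| <= (1 + L * K) * `|x - y| + L * mu x.
  move=> Yy; have : `|y| <= L * (mu x + K * `|x - y|).
    apply: Y_le => // n; rewrite -[y in psi n y](subKr x) raddfB.
    apply: le_trans (ler_normB _ _) _; apply: lerD; [exact: psi_mu|exact: psi_le].
  rewrite mulrDr mulrA mulrDl mul1r.
  by have := ler_normD (x - y) y; rewrite subrK; lra.
have LK : 0 < 1 + L * K by rewrite addr_gt0// mulr_gt0.
have : `|x| <= (1 + L * K) * dist x + L * mu x.
  rewrite -lerBlDr -ler_pdivrMl//; apply: le_inf_image => // y Yy.
  by rewrite ler_pdivrMl// lerBlDr; exact: H.
move=> /le_trans; apply; rewrite [leRHS]mulrDl lerD2r -mulrA ler_pM2l//.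
by rewrite ler_pdivlMl ?mulr_gt0.
Qed.

Let mu_upper x : mu x <= 2 * K * `|x|.
Proof.
apply: mu_le => [n|].
  apply: le_trans (psi_le n x) _; rewrite -mulrA ler_peMl ?ler1n//.
  by rewrite mulr_ge0// ltW.
rewrite ler_pM2l ?mulr_gt0//.
by have := dist_le x Y0; rewrite subr0.
Qed.

Let mu_eq0 x : mu x = 0 -> x = 0.
Proof.
move=> x0; apply/eqP; rewrite -normr_le0.
by apply: le_trans (mu_lower x) _; rewrite x0 mulr0.
Qed.

(** Adding [s *: e n], an element of [Y], changes only the n-th coordinate and does not increase the
    distance to [Y]. If [mu y] is positive, that coordinate has room to grow; the term [s ^+ 2]
    serves the case [y = 0]. *)
Let mu_flat y : exists n0 c, 0 < c /\ forall n s, (n0 <= n)%N -> `|s| <= c ->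
  mu (y + s *: e n) ^+ 2 <= mu y ^+ 2 + s ^+ 2.
Proof.
have dist_e n s : dist (y + s *: e n) <= dist y.
  apply: le_trans (distD _ _) _.
  rewrite gerDl (le_trans (dist_le _ (YZ s (Ye n))))//.
  by rewrite subrr normr0.
have mu0 : 0 <= mu y := le_trans (normr_ge0 _) (psi_mu y 0).
have [y0|ypos] := eqVneq (mu y) 0.
  rewrite (mu_eq0 y0); exists 0%N, 1; split => // n s _ _.
  have -> : mu 0 = 0 by rewrite -(scale0r 0) muZ normr0 mul0r.
  rewrite expr0n add0r add0r -[leRHS]real_normK ?num_real//.
  rewrite ler_pXn2r ?nnegrE//; last first.
    by rewrite (le_trans (normr_ge0 _) (psi_mu _ 0)).
  apply: mu_le => [m|].
    rewrite linearZ/= psie normrM ler_piMr//.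
    by case: eqP; rewrite ?normr1 ?normr0.
  have := dist_le (s *: e n) (YZ s (Ye n)); rewrite subrr normr0 => d0.
  by rewrite (le_trans _ (normr_ge0 s))// mulr_ge0_le0// mulr_ge0// ltW.
have {mu0}ypos : 0 < mu y by rewrite lt_def ypos.
(* The budget for the n-th coordinate, in units of [mu y]: [psi n (y - y')] takes at most 1/2 + 1/6,
   [psi n y'] at most 1/6 for large [n], and [s] at most 1/6. *)
have [] := @dist_lt y (mu y / (6 * K)); first by rewrite divr_gt0// mulr_gt0.
move=> y' Yy' hy'.
have {hy'} hy' : K * `|y - y'| <= 2 / 3 * mu y.
  have : K * `|y - y'| <= K * (dist y + mu y / (6 * K)).
    by rewrite ler_pM2l// ltW.
  have -> : K * (dist y + mu y / (6 * K)) = K * dist y + mu y / 6.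
    by field; rewrite gt_eqF.
  by have := dist_mu y; lra.
have /cvgrPdist_lt /(_ (mu y / 6) ltac:(lra)) [n0 _ hn0] := psi_cvg0 Yy'.
exists n0, (mu y / 6); split; first lra.
move=> n s /hn0 /=; rewrite sub0r normrN => psin sle.
suff h : mu (y + s *: e n) <= mu y.
  have : mu (y + s *: e n) ^+ 2 <= mu y ^+ 2.
    by rewrite ler_pXn2r ?nnegrE // (le_trans (normr_ge0 _) (psi_mu _ 0)).
  by have := sqr_ge0 s; lra.
apply: mu_le => [m|]; last first.
  by apply: le_trans (dist_mu y); rewrite ler_pM2l ?mulr_gt0.
rewrite linearD linearZ/= psie; have [->|mn] := eqVneq m n; last first.
  by rewrite mulr0 addr0; exact: psi_mu.
rewrite mulr1; apply: le_trans (ler_normD _ _) _.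
have := ler_normD (psi n (y - y')) (psi n y'); rewrite -raddfD subrK.
have := psi_le n (y - y'); lra.
Qed.

Lemma c0_flat_norm : exists2 mu' : norm_on X, equivalent_norm mu' &
  forall y, exists n0 c, 0 < c /\ forall n s, (n0 <= n)%N -> `|s| <= c ->
    mu' (y + s *: e n) ^+ 2 <= mu' y ^+ 2 + s ^+ 2.
Proof.
exists (NormOn muD muZ mu_eq0); last exact: mu_flat.
pose D := (1 + L * K) / (2 * K) + L.
have D0 : 0 < D by rewrite addr_gt0// divr_gt0// ?addr_gt0// mulr_gt0.
exists D^-1, (2 * K); split; rewrite ?invr_gt0 ?mulr_gt0// => x.
by rewrite ler_pdivrMl// mu_lower mu_upper.
Qed.

End C0Norm.

Section C0Copy.
Context {R : realType} {X : normedModType R}.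

Lemma c0_copy_flat_norm (Y : set X) :
  linear_subspace Y -> isomorphic (c0 R) Y ->
  exists (e : nat -> X) (psi : nat -> {scalar X}) (K : R),
  [/\ 0 < K /\ forall n x, `|psi n x| <= K * `|x|,
      forall n m, psi n (e m) = (n == m)%:R,
      forall (f : {scalar X}) C, (forall x, `|f x| <= C * `|x|) ->
        forall M, \sum_(m < M) `|f (e m)| <= C * K &
      exists2 mu : norm_on X, equivalent_norm mu &
      forall y, exists n0 c, 0 < c /\ forall n s, (n0 <= n)%N -> `|s| <= c ->
        mu (y + s *: e n) ^+ 2 <= mu y ^+ 2 + s ^+ 2].
Proof.
move=> /linear_subspaceP[Y0 YL] [T [S [[TY SY] [TK SK] TL Tcont Scont]]].
have {}TK u : c0 R u -> S (T u) = u by move=> cu; apply: TK; rewrite inE.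
have {}SK y : Y y -> T (S y) = y by move=> Yy; apply: SK; rewrite inE.
have {}TL a u v : c0 R u -> c0 R v -> T (a *: u + v) = a *: T u + T v.
  by move=> cu cv; apply: TL; rewrite inE.
have SL a x y : Y x -> Y y -> S (a *: x + y) = a *: S x + S y.
  move=> Yx Yy; rewrite -[in LHS](SK x)// -[in LHS](SK y)// -TL; do ?exact: SY.
  by rewrite TK//; apply: c0_linear; exact: SY.
have [B B0 TB] := within_continuous_linear_bounded (@c0_0 R) (@c0_linear R) TL Tcont.
have [A A0 SA] := within_continuous_linear_bounded Y0 YL SL Scont.
pose e n := T (ell_infty_unit R n).
have Ye n : Y (e n) by apply: TY; exact: c0_unit.
have ND (x y : X) : A * `|x + y| <= A * `|x| + A * `|y|.
  by rewrite -mulrDr ler_pM2l// ler_normD.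
have NZ a (x : X) : A * `|a *: x| = `|a| * (A * `|x|) by rewrite normrZ mulrCA.
have /choice[psi psiP] n : exists g : {scalar X},
    (forall y, Y y -> g y = S y n) /\ forall x, `|g x| <= A * `|x|.
  have [||g gY gN] :=
    @hahn_banach_extension _ _ Y (fun y => S y n) (fun x => A * `|x|) Y0 YL _ ND NZ.
  - by move=> a x y Yx Yy; rewrite SL.
  - move=> y Yy; apply: le_trans (SA _ Yy); exact: ell_infty_norm_ub.
  - by exists g.
(* One constant for both directions: [A] bounds [S], hence [psi], and [B] bounds [T], hence the sums
   over [e]. *)
pose K := Num.max A B.
have AK : A <= K by rewrite le_max lexx.
have BK : B <= K by rewrite le_max lexx orbT.
have K0 : 0 < K by exact: lt_le_trans AK.
have psiK n x : `|psi n x| <= K * `|x|.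
  by have [_ /(_ x)/le_trans] := psiP n; apply; rewrite ler_wpM2r.
have psie n m : psi n (e m) = (n == m)%:R.
  by have [->//] := psiP n; rewrite TK//; exact: c0_unit.
exists e, psi, K; split => //.
- move=> f C fC M.
  have C0 : 0 <= C.
    have e0 : e 0%N != 0.
      apply/eqP => /(congr1 (psi 0%N)); rewrite psie raddf0 => /eqP.
      by rewrite oner_eq0.
    have := le_trans (normr_ge0 _) (fC (e 0%N)).
    by rewrite pmulr_lge0// normr_gt0.
  pose s m := Num.sg (f (e m)).
  have [w [cw wE fw]] : exists w : ell_infty R, [/\ c0 R w,
      forall n, w n = if (n < M)%N then s n else 0 &
      f (T w) = \sum_(m < M) `|f (e m)|].
    elim: M => [|M [w [cw wE fw]]].
      exists 0; split=> //; first exact: c0_0.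
      rewrite big_ord0; have := TL (-1) 0 0 (@c0_0 R) (@c0_0 R).
      by rewrite !scaleN1r !addNr => ->; rewrite raddf0.
    exists (s M *: ell_infty_unit R M + w); split.
    + by apply: c0_linear => //; exact: c0_unit.
    + move=> n; have -> : (s M *: ell_infty_unit R M + w) n =
        s M * (n == M)%:R + w n by [].
      rewrite wE [in RHS]ltnS [in RHS]leq_eqVlt; have [->|_] /= := eqVneq n M.
        by rewrite ltnn mulr1 addr0.
      by rewrite mulr0 add0r.
    + rewrite TL//; last exact: c0_unit.
      rewrite linearD linearZ/= fw big_ord_recr/= addrC; congr (_ + _).
      by rewrite -/(e M) /s [RHS]normrEsg.
  rewrite -fw (le_trans (ler_norm _))// (le_trans (fC _))// ler_wpM2l//.
  rewrite (le_trans (TB _ cw))// -[leRHS]mulr1 ler_pM ?(ltW B0)//.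
  apply: ell_infty_norm_le => n; rewrite wE; case: ifP; rewrite ?normr0//.
  by rewrite /s normr_sg; case: (_ == 0).
apply: (@c0_flat_norm _ _ Y e psi K B) => //.
- move=> y Yy; rewrite (_ : (fun n => psi n y) = (S y : nat -> R)); first exact: SY.
  by apply/funext => n; have [->] := psiP n.
- move=> y r Yy yr; rewrite -{1}(SK y Yy) (le_trans (TB _ (SY _ Yy)))//.
  rewrite ler_pM2l//; apply: ell_infty_norm_le => n.
  by have [<-] := psiP n.
Qed.

End C0Copy.

(** * Smoothing by infimal convolution *)

Section NormOn.
Context {R : realType} {V : lmodType R}.
Implicit Types (p : norm_on V) (x y : V).

Lemma norm_on0 p : p 0 = 0.
Proof. by rewrite -(scale0r 0) norm_onZ normr0 mul0r. Qed.

Lemma norm_onN p x : p (- x) = p x.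
Proof. by rewrite -scaleN1r norm_onZ normrN1 mul1r. Qed.

Lemma norm_on_ge0 p x : 0 <= p x.
Proof. by have := norm_onD p x (- x); rewrite subrr norm_on0 norm_onN; lra. Qed.

Lemma norm_on_gt0 p x : x != 0 -> 0 < p x.
Proof.
move=> x0; rewrite lt_def norm_on_ge0 andbT.
by apply: contra_neq x0; exact: norm_on0_eq0.
Qed.

Lemma norm_on_distD p x y : `|p x - p y| <= p (x - y).
Proof.
have := norm_onD p (x - y) y; have := norm_onD p (y - x) x.
by rewrite !subrK -[y - x]opprB norm_onN ler_norml; lra.
Qed.

Definition convex (phi : V -> R) := forall t x y, 0 <= t <= 1 ->
  phi (t *: x + (1 - t) *: y) <= t * phi x + (1 - t) * phi y.

Lemma convex_sqr_norm p : convex (fun x => p x ^+ 2).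
Proof.
move=> t x y /andP[t0 t1].
have := norm_onD p (t *: x) ((1 - t) *: y).
rewrite !norm_onZ !ger0_norm ?subr_ge0//.
have := norm_on_ge0 p (t *: x + (1 - t) *: y).
move: (p (_ + _)) (p x) (p y) => c a b c0 cab.
have : c ^+ 2 <= (t * a + (1 - t) * b) ^+ 2.
  by rewrite ler_pXn2r ?nnegrE// (le_trans c0).
move=> /le_trans; apply.
have : 0 <= t * (1 - t) * (a - b) ^+ 2.
  by rewrite mulr_ge0 ?sqr_ge0// mulr_ge0// subr_ge0.
lra.
Qed.

Lemma convexD (phi psi : V -> R) :
  convex phi -> convex psi -> convex (fun x => phi x + psi x).
Proof.
move=> cf cg t x y t01; have := cf t x y t01; have := cg t x y t01; lra.
Qed.

Lemma convexZ (c : R) (phi : V -> R) : 0 <= c ->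
  convex phi -> convex (fun x => c * phi x).
Proof.
move=> c0 cf t x y t01; have := ler_wpM2l c0 (cf t x y t01); lra.
Qed.

(** The triangle inequality is the convexity of the set where [phi] is at most 1: with [a], [b] the
    square roots of [phi x] and [phi y], the vector [x + y] is [a + b] times a convex combination of
    [a^-1 *: x] and [b^-1 *: y]. *)
Lemma sqrt_norm_on (phi : V -> R) : (forall x, 0 <= phi x) ->
  (forall a x, phi (a *: x) = a ^+ 2 * phi x) -> convex phi ->
  (forall x, phi x = 0 -> x = 0) ->
  {p : norm_on V | forall x, p x = Num.sqrt (phi x)}.
Proof.
move=> phi0 phiZ phic phieq0.
have pD x y : Num.sqrt (phi (x + y)) <= Num.sqrt (phi x) + Num.sqrt (phi y).
  have [->|x0] := eqVneq x 0; first by rewrite add0r lerDr sqrtr_ge0.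
  have [->|y0] := eqVneq y 0; first by rewrite addr0 lerDl sqrtr_ge0.
  have pos z : z != 0 -> 0 < Num.sqrt (phi z).
    move=> z0; rewrite sqrtr_gt0 lt_def phi0 andbT.
    by apply: contra_neq z0; exact: phieq0.
  move: (pos _ x0) (pos _ y0).
  set a := Num.sqrt (phi x); set b := Num.sqrt (phi y) => a0 b0.
  have ab0 : 0 < a + b by rewrite addr_gt0.
  have aE : a ^+ 2 = phi x by rewrite sqr_sqrtr.
  have bE : b ^+ 2 = phi y by rewrite sqr_sqrtr.
  have -> : x + y = (a + b) *: (a / (a + b) *: (a^-1 *: x) +
      (1 - a / (a + b)) *: (b^-1 *: y)).
    rewrite scalerDr !scalerA; congr (_ + _); rewrite -[LHS]scale1r;
      congr (_ *: _); field; rewrite ?gt_eqF//.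
  rewrite phiZ -[leRHS]gtr0_norm// -sqrtr_sqr ler_wsqrtr// ler_piMr ?sqr_ge0//.
  apply: le_trans (phic _ _ _ _) _.
    by rewrite divr_ge0 ?(ltW a0) ?(ltW ab0)//= ler_pdivrMr// mul1r lerDl ltW.
  rewrite !phiZ -aE -bE -!exprMn !mulVf ?gt_eqF// expr1n; lra.
have pZ a x : Num.sqrt (phi (a *: x)) = `|a| * Num.sqrt (phi x).
  by rewrite phiZ sqrtrM ?sqr_ge0// sqrtr_sqr.
have p0 x : Num.sqrt (phi x) = 0 -> x = 0.
  move=> /eqP; rewrite sqrtr_eq0 => h; apply: phieq0.
  by apply/eqP; rewrite eq_le h phi0.
by exists (NormOn pD pZ p0).
Qed.

End NormOn.

Section Smoothing.
Context {R : realType} {X : completeNormedModType R} {H : lmodType R}.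
Context (T : {linear H -> X}) (Q : H -> R) (D : R).
(* [QE] expresses that [Q] is a quadratic form. *)
Context (Q_ge0 : forall z, 0 <= Q z)
  (QE : forall a b u v, Q (a *: u + b *: v) =
     a * (a + b) * Q u + b * (a + b) * Q v - a * b * Q (u - v))
  (TQ : forall z, `|T z| ^+ 2 <= D * Q z).
Context (mu : norm_on X) (c C : R) (c_gt0 : 0 < c) (C_gt0 : 0 < C)
  (mu_equiv : forall x, c * `|x| <= mu x <= C * `|x|).

Let F x z := mu (x - T z) ^+ 2 + Q z.
Let phi x := inf (range (F x)).

Let F_ge0 x z : 0 <= F x z.
Proof. by rewrite addr_ge0// sqr_ge0. Qed.

Let phi_le x z : phi x <= F x z.
Proof. by apply: inf_image_le. Qed.

Let phi_ge x r : (forall z, r <= F x z) -> r <= phi x.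
Proof. by move=> rF; apply: le_inf_image => //; exists 0. Qed.

Let phi_lt x eps : 0 < eps -> exists z, F x z < phi x + eps.
Proof.
move=> e0; have [||z _ ?] := @inf_image_lt _ _ setT (F x) 0 _ _ _ e0 => //.
  by exists 0.
by exists z.
Qed.

Let phi_ge0 x : 0 <= phi x. Proof. exact: phi_ge. Qed.

Let QZ a z : Q (a *: z) = a ^+ 2 * Q z.
Proof.
by have := QE a 0 z 0; rewrite scale0r addr0 => ->; rewrite !mulr0 !mul0r; ring.
Qed.

Let Q0 : Q 0 = 0.
Proof. by rewrite -(scale0r (0 : H)) QZ expr0n mul0r. Qed.

Let phiZ a x : phi (a *: x) = a ^+ 2 * phi x.
Proof.
have le b y : phi (b *: y) <= b ^+ 2 * phi y.
  have [->|b0] := eqVneq b 0.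
    rewrite scale0r expr0n mul0r (le_trans (phi_le 0 0))// /F.
    by rewrite raddf0 subr0 norm_on0 Q0 expr0n addr0.
  have b20 : 0 < b ^+ 2 by rewrite exprn_even_gt0.
  rewrite -ler_pdivrMl//; apply: phi_ge => z; rewrite ler_pdivrMl//.
  apply: le_trans (phi_le _ (b *: z)) _.
  by rewrite /F linearZ/= -scalerBr norm_onZ QZ exprMn real_normK ?num_real// mulrDr.
apply/eqP; rewrite eq_le le/=; have [->|a0] := eqVneq a 0.
  by rewrite expr0n mul0r phi_ge0.
rewrite -ler_pdivlMl ?exprn_even_gt0// -exprVn.
by have := le a^-1 (a *: x); rewrite scalerA mulVf// scale1r.
Qed.

Let Qconvex : convex Q.
Proof.
move=> t u v /andP[t0 t1]; rewrite QE.
have : 0 <= t * (1 - t) * Q (u - v) by rewrite !mulr_ge0// subr_ge0.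
lra.
Qed.

Let phi_convex : convex phi.
Proof.
move=> t x y t01; have /andP[t0 t1] := t01.
apply/ler_addgt0Pr => e e0.
have [z hz] := phi_lt x e0; have [w hw] := phi_lt y e0.
apply: le_trans (phi_le _ (t *: z + (1 - t) *: w)) _.
have : F (t *: x + (1 - t) *: y) (t *: z + (1 - t) *: w) <=
    t * F x z + (1 - t) * F y w.
  rewrite /F (_ : _ - T _ = t *: (x - T z) + (1 - t) *: (y - T w)); last first.
    by rewrite [T _]linearD ![T (_ *: _)]linearZ/= !scalerBr addrACA -opprD.
  have := Qconvex z w t01; have := convex_sqr_norm mu (x - T z) (y - T w) t01.
  by rewrite /=; lra.
move=> /le_trans; apply.
have h : 0 <= t * (phi x + e - F x z) by rewrite mulr_ge0// subr_ge0 ltW.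
have : 0 <= (1 - t) * (phi y + e - F y w) by rewrite mulr_ge0 // subr_ge0 // ltW.
lra.
Qed.

Let sqrD_le (a b : R) : (a + b) ^+ 2 <= 2 * a ^+ 2 + 2 * b ^+ 2.
Proof. by have := sqr_ge0 (a - b); lra. Qed.

(** The constant comes from squaring [|x| <= |x - T z| + |T z|] and bounding the two terms by
    [mu (x - T z)] and [Q z]. *)
Let D' := 2 / c ^+ 2 + 2 * `|D|.

Let D'_gt0 : 0 < D'.
Proof. by rewrite ltr_wpDr ?mulr_ge0// divr_gt0// exprn_gt0. Qed.

Let phi_lower x : `|x| ^+ 2 <= D' * phi x.
Proof.
rewrite -ler_pdivrMl//; apply: phi_ge => z; rewrite ler_pdivrMl//.
have h : `|x| ^+ 2 <= (`|x - T z| + `|T z|) ^+ 2.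
  by rewrite ler_pXn2r ?nnegrE ?addr_ge0// -{1}(subrK (T z) x) ler_normD.
apply: le_trans h _; apply: le_trans (sqrD_le _ _) _.
have h1 : `|x - T z| ^+ 2 <= c ^- 2 * mu (x - T z) ^+ 2.
  rewrite -exprVn -exprMn ler_pXn2r ?nnegrE ?mulr_ge0 ?norm_on_ge0 ?invr_ge0 ?(ltW c_gt0)//.
  by rewrite ler_pdivlMl//; case/andP: (mu_equiv (x - T z)).
have h2 : `|T z| ^+ 2 <= `|D| * Q z.
  by apply: le_trans (TQ z) _; rewrite ler_wpM2r// ler_norm.
have h3 : 0 <= 2 / c ^+ 2 * Q z by rewrite mulr_ge0// divr_ge0// sqr_ge0.
have h4 : 0 <= 2 * `|D| * mu (x - T z) ^+ 2 by rewrite mulr_ge0 ?sqr_ge0// mulr_ge0.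
by rewrite /D' /F; lra.
Qed.

Let phi_upper x : phi x <= mu x ^+ 2.
Proof.
apply: le_trans (phi_le x 0) _.
by rewrite /F raddf0 subr0 Q0 addr0.
Qed.

Let phi_eq0 x : phi x = 0 -> x = 0.
Proof.
move=> x0; have := phi_lower x; rewrite x0 mulr0 => h; apply/eqP.
by rewrite -normr_eq0 -sqrf_eq0 eq_le h sqr_ge0.
Qed.

(** Moving a near-minimizer [z] to [z + h] and [z - h] leaves the [mu] term unchanged, and the
    parallelogram law for [Q] handles the rest. *)
Let phi_smooth x h : phi (x + T h) + phi (x - T h) <= 2 * phi x + 2 * Q h.
Proof.
apply/ler_addgt0Pr => e e0; have e2 : 0 < e / 2 by lra.
have [z hz] := phi_lt x e2.
have := phi_le (x + T h) (z + h); have := phi_le (x - T h) (z - h).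
have -> : F (x + T h) (z + h) = mu (x - T z) ^+ 2 + Q (z + h).
  by rewrite /F linearD opprD addrACA subrr addr0.
have -> : F (x - T h) (z - h) = mu (x - T z) ^+ 2 + Q (z - h).
  by rewrite /F linearB opprB addrA subrK.
by have := QE 1 1 z h; rewrite !scale1r; move: hz; rewrite /F; lra.
Qed.

(** At the midpoint of [z] and [w] the quadratic form gains [Q (z - w) / 4] over the average, while
    [F x] cannot fall below [phi x]. *)
Let Q_near_min x z w (e : R) : F x z < phi x + e -> F x w < phi x + e ->
  Q (z - w) <= 4 * e.
Proof.
move=> hz hw.
have := phi_le x (2^-1 *: z + (1 - 2^-1) *: w).
have t01 : 0 <= (2^-1 : R) <= 1 by lra.
rewrite /F (_ : x - T _ = 2^-1 *: (x - T z) + (1 - 2^-1) *: (x - T w)); last first.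
  rewrite [T _]linearD ![T (_ *: _)]linearZ/= !scalerBr addrACA -opprD.
  by rewrite -scalerDl subrKC scale1r.
have := convex_sqr_norm mu (x - T z) (x - T w) t01.
by rewrite QE; rewrite /F in hz hw; lra.
Qed.

(** For a minimizing sequence [z n], the points [T (z n)] are Cauchy by [Q_near_min], and [y] is the
    limit of [x - T (z n)]. Using [z n] as competitor for [x + v] cancels [Q (z n)] and leaves a
    difference of squares of [mu]. *)
Let phi_tangent x : exists y, forall v,
  phi (x + v) - phi x <= mu (y + v) ^+ 2 - mu y ^+ 2.
Proof.
pose e n : R := n.+1%:R^-1.
have e0 n : 0 < e n by rewrite invr_gt0.
have e_le m n : (m <= n)%N -> e n <= e m.
  by move=> mn; rewrite lef_pV2 ?posrE// ler_nat.
have e_cvg : e n @[n --> \oo] --> (0 : R) by exact: cvg_harmonic.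
have /choice[z hz] n := phi_lt x (e0 n).
have TQz m n : (m <= n)%N -> `|T (z m) - T (z n)| ^+ 2 <= `|D| * (4 * e m).
  move=> mn; rewrite -raddfB (le_trans (TQ _))//.
  rewrite (le_trans (ler_wpM2r _ (ler_norm D)))// ler_wpM2l//.
  apply: (@Q_near_min x) => //; apply: lt_le_trans (hz n) _.
  by rewrite lerD2l e_le.
have /cvg_ex[l /= zl] : cvgn (fun n => x - T (z n)).
  apply/cauchy_cvgP/cauchy_exP => eps eps0.
  have d0 : 0 < eps ^+ 2 / (4 * `|D| + 1).
    by rewrite divr_gt0 ?exprn_gt0// ltr_wpDl// mulr_ge0.
  have /cvgrPdist_lt /(_ _ d0) [N _ hN] := e_cvg.
  exists (x - T (z N)); exists N => // n /= Nn.
  rewrite -ball_normE /=.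
  have -> : x - T (z N) - (x - T (z n)) = T (z n) - T (z N).
    by rewrite opprB addrC addrA subrK.
  rewrite distrC -(@ltr_pXn2r _ 2%N) ?nnegrE ?(ltW eps0)//.
  apply: le_lt_trans (TQz _ _ Nn) _.
  have := hN N (leqnn N); rewrite /= sub0r normrN gtr0_norm// ltr_pdivlMr; last first.
    by rewrite ltr_wpDl// mulr_ge0.
  by move=> h; have := e0 N; lra.
have mu_cvg v : mu (x - T (z n) + v) @[n --> \oo] --> mu (l + v).
  apply/cvgrPdist_lt => eps eps0.
  move/cvgrPdist_lt : zl => /(_ _ (divr_gt0 eps0 C_gt0)); apply: filterS => n.
  rewrite ltr_pdivlMr// mulrC; apply: le_lt_trans.
  apply: le_trans (norm_on_distD _ _ _) _.
  rewrite (opprD _ v) addrACA subrr addr0.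
  by case/andP: (mu_equiv (l - (x - T (z n)))).
exists l => v.
have sq_cvg u : mu (x - T (z n) + u) ^+ 2 @[n --> \oo] --> mu (l + u) ^+ 2.
  by rewrite expr2; under eq_fun do rewrite expr2; apply: cvgM; exact: mu_cvg.
have lim_cvg : mu (x - T (z n) + v) ^+ 2 + e n - mu (x - T (z n) + 0) ^+ 2
    @[n --> \oo] --> mu (l + v) ^+ 2 + 0 - mu (l + 0) ^+ 2.
  by apply: cvgB; [apply: cvgD|].
rewrite !addr0 in lim_cvg.
apply: cvgr_to_ge lim_cvg _.
apply: nearW => n /=; have := phi_le (x + v) (z n); have := hz n.
by rewrite /F addr0 (addrAC x v); lra.
Qed.

Lemma smooth_norm : exists2 q : norm_on X, equivalent_norm q &
  (forall x, exists y, forall v,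
     q (x + v) ^+ 2 - q x ^+ 2 <= mu (y + v) ^+ 2 - mu y ^+ 2) /\
  (forall x h, q (x + T h) ^+ 2 + q (x - T h) ^+ 2 <= 2 * q x ^+ 2 + 2 * Q h).
Proof.
have [q qE] := sqrt_norm_on phi_ge0 phiZ phi_convex phi_eq0.
have q2 x : q x ^+ 2 = phi x by rewrite qE sqr_sqrtr.
exists q; last first.
  split=> [x|x h]; last by rewrite !q2.
  by have [y hy] := phi_tangent x; exists y => v; rewrite !q2.
exists (Num.sqrt D')^-1, C; split; rewrite ?invr_gt0 ?sqrtr_gt0// => x.
apply/andP; split.
  rewrite ler_pdivrMl ?sqrtr_gt0// qE -sqrtrM ?(ltW D'_gt0)//.
  by rewrite -[leLHS]normr_id -sqrtr_sqr ler_wsqrtr.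
have /andP[_ muC] := mu_equiv x; apply: le_trans muC.
by rewrite qE -[leRHS](ger0_norm (norm_on_ge0 mu x)) -sqrtr_sqr ler_wsqrtr.
Qed.

End Smoothing.

Section SmoothDirections.
Context {R : realType} {X : completeNormedModType R} (d : nat -> X).

(** The normalization gives [|g i| <= 2^-i], which makes [T] bounded for the l_2 norm. *)
Let g i : X := (2 ^+ i * (1 + `|d i|))^-1 *: d i.

(** Finitely supported sequences are encoded as polynomials, with ['X^i] as the i-th basis vector;
    [Q] is the square of the l_2 norm. *)
Let T (z : {poly R}) : X := \sum_(i < size z) z`_i *: g i.
Let Q (z : {poly R}) : R := \sum_(i < size z) z`_i ^+ 2.

Let T_widen n (z : {poly R}) : (size z <= n)%N -> T z = \sum_(i < n) z`_i *: g i.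
Proof.
move=> zn; rewrite /T (big_ord_widen _ (fun i => z`_i *: g i) zn) big_mkcond/=.
by apply: eq_bigr => i _; case: ltnP => // zi; rewrite nth_default// scale0r.
Qed.

Let Q_widen n (z : {poly R}) : (size z <= n)%N -> Q z = \sum_(i < n) z`_i ^+ 2.
Proof.
move=> zn; rewrite /Q (big_ord_widen _ (fun i => z`_i ^+ 2) zn) big_mkcond/=.
by apply: eq_bigr => i _; case: ltnP => // zi; rewrite nth_default// expr0n.
Qed.

Let size_comb n (a b : R) (u v : {poly R}) : (size u <= n)%N -> (size v <= n)%N ->
  (size (a *: u + b *: v)%R <= n)%N.
Proof.
move=> un vn; rewrite (leq_trans (size_polyD _ _))// geq_max.
by rewrite !(leq_trans (size_scale_leq _ _)).
Qed.

Let T_linear : linear T.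
Proof.
move=> a u v; pose n := maxn (size u) (size v).
have un : (size u <= n)%N by exact: leq_maxl.
have vn : (size v <= n)%N by exact: leq_maxr.
have := size_comb a 1 un vn; rewrite scale1r => uvn.
rewrite (T_widen un) (T_widen vn) (T_widen uvn) scaler_sumr -big_split/=.
by apply: eq_bigr => i _; rewrite coefD coefZ scalerDl scalerA.
Qed.

Let QE a b u v : Q (a *: u + b *: v) =
  a * (a + b) * Q u + b * (a + b) * Q v - a * b * Q (u - v).
Proof.
pose n := maxn (size u) (size v).
have un : (size u <= n)%N by exact: leq_maxl.
have vn : (size v <= n)%N by exact: leq_maxr.
have := size_comb 1 (-1) un vn; rewrite scale1r scaleN1r => uvn.
rewrite (Q_widen un) (Q_widen vn) (Q_widen uvn) (Q_widen (size_comb a b un vn)).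
rewrite !mulr_sumr -big_split/= -sumrB; apply: eq_bigr => i _.
by rewrite coefD !coefZ coefB; ring.
Qed.

Let Q_ge0 z : 0 <= Q z.
Proof. by apply: sumr_ge0 => i _; exact: sqr_ge0. Qed.

Let g_le i : `|g i| <= 2^-1 ^+ i.
Proof.
have d0 : 0 < 1 + `|d i| by rewrite ltr_wpDr.
have k0 : 0 < 2 ^+ i * (1 + `|d i|) by rewrite mulr_gt0 ?exprn_gt0.
rewrite normrZ gtr0_norm ?invr_gt0// invfM -mulrA exprVn.
by rewrite ler_piMr ?invr_ge0 ?exprn_ge0// ler_pdivrMl// mulr1 lerDr.
Qed.

(** Each coefficient is at most the root of [Q z], and the norms [|g i|] sum to at most 2. *)
Let T_le z : `|T z| ^+ 2 <= 4 * Q z.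
Proof.
have zQ i : `|z`_i| <= Num.sqrt (Q z).
  rewrite -sqrtr_sqr ler_wsqrtr//; have [iz|zi] := ltnP i (size z).
    by rewrite /Q (bigD1 (Ordinal iz))//= lerDl sumr_ge0// => j _; exact: sqr_ge0.
  by rewrite nth_default// expr0n.
have geo n : \sum_(i < n) 2^-1 ^+ i = 2 - 2 * 2^-1 ^+ n :> R.
  by elim: n => [|n IH]; rewrite ?big_ord0 ?big_ord_recr/= ?IH ?exprS; lra.
have : `|T z| <= 2 * Num.sqrt (Q z).
  apply: le_trans (ler_norm_sum _ _ _) _.
  have : \sum_(i < size z) `|z`_i *: g i| <=
      \sum_(i < size z) Num.sqrt (Q z) * 2^-1 ^+ i.
    by apply: ler_sum => i _; rewrite normrZ ler_pM.
  rewrite -mulr_sumr geo => /le_trans; apply.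
  by rewrite mulrC ler_wpM2r ?sqrtr_ge0// lerBlDr lerDl mulr_ge0// exprn_ge0.
rewrite -(@ler_pXn2r _ 2%N) ?nnegrE ?mulr_ge0 ?sqrtr_ge0//.
by rewrite exprMn sqr_sqrtr// -natrX.
Qed.

Lemma smooth_norm_directions (mu : norm_on X) : equivalent_norm mu ->
  exists2 q : norm_on X, equivalent_norm q &
  (forall x, exists y, forall v,
     q (x + v) ^+ 2 - q x ^+ 2 <= mu (y + v) ^+ 2 - mu y ^+ 2) /\
  (forall x i, exists C, forall s,
     q (x + s *: d i) ^+ 2 + q (x - s *: d i) ^+ 2 <= 2 * q x ^+ 2 + C * s ^+ 2).
Proof.
move=> [c [C [c0 C0 muE]]].
pose L := GRing.isLinear.Build R {poly R} X *:%R T T_linear.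
pose T' : {linear {poly R} -> X} := HB.pack T L.
have [q qeq [q_tangent q_smooth]] :=
  @smooth_norm _ _ _ T' Q _ Q_ge0 QE T_le mu c C c0 C0 muE.
exists q => //; split=> // x i.
(* [k] undoes the normalization of [g i], so that [(s * k) *: 'X^i] is sent to [s *: d i]. *)
pose k := 2 ^+ i * (1 + `|d i|).
have k0 : k != 0.
  by rewrite gt_eqF// mulr_gt0 ?exprn_gt0// ltr_wpDr.
have TX s : T' ((s * k) *: 'X^i) = s *: d i.
  have sz : (size ((s * k) *: 'X^i : {poly R})%R <= i.+1)%N.
    by rewrite (leq_trans (size_scale_leq _ _))// size_polyXn.
  rewrite /= (T_widen sz) big_ord_recr/= big1 ?add0r => [|j _].
    by rewrite coefZ coefXn eqxx mulr1 /g scalerA -/k mulfK.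
  by rewrite coefZ coefXn ltn_eqF// mulr0 scale0r.
have QX s : Q ((s * k) *: 'X^i) = k ^+ 2 * s ^+ 2.
  have sz : (size ((s * k) *: 'X^i : {poly R})%R <= i.+1)%N.
    by rewrite (leq_trans (size_scale_leq _ _))// size_polyXn.
  rewrite (Q_widen sz) big_ord_recr/= big1 ?add0r => [|j _].
    by rewrite coefZ coefXn eqxx mulr1 exprMn mulrC.
  by rewrite coefZ coefXn ltn_eqF// mulr0 expr0n.
exists (2 * k ^+ 2) => s.
by have := q_smooth x ((s * k) *: 'X^i); rewrite TX QX; lra.
Qed.

End SmoothDirections.

(** * Total and direction sequences *)

Section TotalSequence.
Context {R : realType} {X : normedModType R}.

Lemma weak_topology_nbhs (f : dual X) (x : X) (eps : R) : 0 < eps ->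
  nbhs (x : weak_topology X) [set y | `|f x - f y| < eps].
Proof.
move=> eps0.
have /cvg_sup /(_ f) xx : nbhs (x : weak_topology X) --> (x : weak_topology X).
  by [].
have := @initial_continuous _ _ (f : X -> R^o) x.
move=> /(cvg_trans (cvg_app f xx)) /cvgrPdist_lt /(_ _ eps0); exact.
Qed.

(* A weakly compact set whose points are separated by countably many
   functionals is weakly separable; [E (k, r)] runs through a dense subset. *)
Lemma total_sequence (phi : nat -> dual X) :
  (forall x, (forall n, phi n x = 0) -> x = 0) ->
  weakly_compactly_generated X ->
  exists d : nat -> X, forall f : dual X, (forall n, f (d n) = 0) -> f = 0.
Proof.
move=> phi_sep [K Kcompact Kdense].
(* [good (k, r) x] says that [x] lies in [K] and that its first [k] coordinates are within
   [1 / (k + 1)] of the rationals in [r]. *)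
pose good (kr : nat * seq rat) x := K x /\ forall i, (i < kr.1)%N ->
  `|phi i x - ratr (nth 0 kr.2 i)| < kr.1.+1%:R^-1 :> R.
have /choice[E EP] (kr : nat * seq rat) :
    exists x, (exists y, good kr y) -> good kr x.
  by have [[y gy]|ng] := pselect (exists y, good kr y); [exists y|exists 0].
exists (fun n => if unpickle n is Some kr then E kr else 0) => f fd.
have {}fd kr : f (E kr) = 0 by have := fd (pickle kr); rewrite pickleK.
have fK x : K x -> f x = 0.
  move=> Kx.
  have /choice[r rP] k : exists r : seq rat, good (k, r) x.
    have k0 : 0 < k.+1%:R^-1 :> R by rewrite invr_gt0.
    have /choice[s sP] i : exists s : rat, `|phi i x - ratr s| < k.+1%:R^-1.
      move: k0; set h : R := k.+1%:R^-1 => h0.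
      have [|s] := @rat_in_itvoo R (phi i x - h) (phi i x + h); first by lra.
      by rewrite in_itv/= => /andP[? ?]; exists s; rewrite ltr_norml; lra.
    exists (mkseq s k); split => // i /= ik.
    by rewrite nth_mkseq.
  (* [y k] shares with [x] the rational approximations [r k], so [phi i (y k)] tends to [phi i x]
     for every [i]. *)
  pose y k : weak_topology X := E (k, r k).
  have yP k : good (k, r k) (y k) by apply: EP; exists x.
  have [|z [Kz clz]] := Kcompact (y @ \oo) (fmap_proper_filter y _).
    by exists 0%N => // k _; have [] := yP k.
  (* Every weak neighbourhood of the cluster point [z] meets each tail of [y]. Applied to all
     [phi i] this gives [z = x], and applied to [f] it gives [f z = 0]. *)
  have lim (g : dual X) l : g (y k) @[k --> \oo] --> (l : R) -> g z = l.
    move=> gl; apply/eqP; rewrite -subr_eq0 -normr_eq0; apply/negPn/negP => h.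
    have {h} e0 : 0 < `|g z - l| / 2 by rewrite divr_gt0// lt_def h normr_ge0.
    have /cvgrPdist_lt /(_ _ e0) glo := gl.
    have [w [/= w1 w2]] :=
      clz [set v | `|l - g v| < `|g z - l| / 2] _ glo (weak_topology_nbhs g z e0).
    have := ler_normB (g z - g w) (l - g w).
    by rewrite opprB addrA subrK; lra.
  suff -> : x = z by apply: lim; under eq_fun do rewrite fd; exact: cvg_cst.
  apply/eqP; rewrite -subr_eq0; apply/eqP/phi_sep => i.
  have phiB u v : phi i (u - v) = phi i u - phi i v.
    have := dual_linear (phi i) (-1) v u.
    by rewrite !scaleN1r (addrC (- v)) => ->; rewrite addrC.
  rewrite phiB; apply/eqP; rewrite subr_eq0; apply/eqP/esym/lim.
  apply/cvgrPdist_lt => e e0.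
  have /cvgrPdist_lt /(_ _ (divr_gt0 e0 (ltr0Sn _ 1))) [N _ hN] :=
    @cvg_harmonic R.
  exists (maxn N i.+1) => // k /=; rewrite geq_max => /andP[Nk ik].
  have [_ /(_ i ik) h1] := rP k; have [_ /(_ i ik) h2] := yP k.
  have := hN k Nk; rewrite /= sub0r normrN ger0_norm ?invr_ge0// => h3.
  have := ler_normB (phi i x - ratr (r k)`_i) (phi i (y k) - ratr (r k)`_i).
  rewrite opprB addrA subrK; move: h1 h2 h3 => /=.
  by move: (k.+1%:R^-1) => h; lra.
have f_span : linear_span K `<=` [set x | f x = 0].
  apply: smallest_sub => //; split; first by rewrite inE; exact: dual0.
  move=> a u v; rewrite !inE /= => fu fv.
  by have := dual_linear f a u v; rewrite fu fv scaler0 addr0.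
apply/val_inj/funext => x /=.
have : closure (linear_span K) x by rewrite Kdense.
move=> /(closure_subset f_span).
have /closure_id <- // : closed [set x | f x = 0].
apply: (@preimage_closed _ _ (f : X -> R^o) [set 0]); last exact: closed_eq.
by move=> u _; exact: dual_continuous.
Qed.

End TotalSequence.

(** * Functionals with prescribed sign patterns *)

Section Directions.
Context {R : realType}.

Lemma injective_nat_unbounded (f : nat -> nat) : injective f ->
  forall N, exists m, (N <= f m)%N.
Proof.
move=> finj N; apply: contrapT => /forallNP fN.
have fltN m : (f m < N)%N by rewrite ltnNge; apply/negP/fN.
pose g (i : 'I_N.+1) := Ordinal (fltN i).
have ginj : injective g.
  by move=> i j /(congr1 val)/= /finj /val_inj.
by have := leq_card g ginj; rewrite !card_ord ltnn.
Qed.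

Lemma norm1_of_sqr (s : R) : s ^+ 2 = 1 -> `|s| = 1.
Proof.
by move=> s1; apply/eqP; rewrite -sqrp_eq1 ?normr_ge0// real_normK ?num_real// s1.
Qed.

Lemma rat_approx (a e : R) : 0 < e -> exists r : rat, `|ratr r - a| <= e.
Proof.
move=> e0; have [|r] := @rat_in_itvoo R (a - e) (a + e); first by lra.
by rewrite in_itv/= => /andP[? ?]; exists r; rewrite ler_norml; lra.
Qed.

Context {X : normedModType R} (phi : nat -> {scalar X}) (A : R).
Context (phi_le : forall n x, `|phi n x| <= A * `|x|)
  (phi_sep : forall x, (forall n, phi n x = 0) -> x = 0).

Let combo i j k (a b c : R) x := a * phi i x + b * phi j x + c * phi k x.

(** Cramer's rule. If all the determinants with a fixed [i] vanished, the combination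
    [- phi i x2 *: x1 + phi i x1 *: x2] would be killed by every functional, hence be zero. *)
Let solve x1 x2 (s : R) : (forall a b, a *: x1 + b *: x2 = 0 -> a = 0 /\ b = 0) ->
  exists i j a b, a * phi i x1 + b * phi j x1 = 1 /\
    a * phi i x2 + b * phi j x2 = s.
Proof.
move=> indep.
have [i xi] : exists i, phi i x1 != 0.
  apply: contrapT => /forallNP h.
  have x10 : x1 = 0 by apply: phi_sep => n; apply/eqP/negPn/negP/h.
  have [|/eqP] := indep 1 0; first by rewrite x10 scaler0 scale0r addr0.
  by rewrite oner_eq0.
have [j xj] : exists j, phi i x1 * phi j x2 - phi i x2 * phi j x1 != 0.
  apply: contrapT => /forallNP h.
  have : - phi i x2 *: x1 + phi i x1 *: x2 = 0.
    apply: phi_sep => n; rewrite linearD !linearZ/=.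
    by have /negP/negPn/eqP := h n; lra.
  by move=> /indep[_ /eqP]; rewrite (negPf xi).
pose D := phi i x1 * phi j x2 - phi i x2 * phi j x1.
exists i, j, ((phi j x2 - s * phi j x1) / D), ((s * phi i x1 - phi i x2) / D).
by split; rewrite /D; field.
Qed.

(** Two functionals suffice for the values 1 and [s] at [x1] and [x2]. If their combination vanishes
    at [x3], a small multiple of a third functional is added. *)
Let exists_combo x1 x2 x3 (s : R) :
  (forall a b, a *: x1 + b *: x2 = 0 -> a = 0 /\ b = 0) -> x3 != 0 ->
  s ^+ 2 = 1 -> exists i j k (a b c : R) m, 0 < m /\
  [/\ m <= combo i j k a b c x1, m <= s * combo i j k a b c x2
    & m <= `|combo i j k a b c x3|].
Proof.
move=> indep x30 s1.
have [i [j [a [b [E1 E2]]]]] := solve s indep.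
have [k xk] : exists k, phi k x3 != 0.
  apply: contrapT => /forallNP h; move/eqP: x30; apply.
  by apply: phi_sep => n; apply/eqP/negPn/negP/h.
pose w := a * phi i x3 + b * phi j x3.
have sn := norm1_of_sqr s1.
have [w0|w0] := eqVneq w 0; last first.
  exists i, j, k, a, b, 0, (Num.min 1 `|w|).
  rewrite lt_min ltr01 normr_gt0 w0; split; first by [].
  rewrite /combo !mul0r !addr0 E1 E2 -expr2 s1 !ge_min !lexx.
  by split=> //; rewrite orbT.
(* The factor [(2 * M)^-1] keeps the change at [x1] and [x2] below 1/2. *)
pose M := `|phi k x1| + `|phi k x2| + 1.
have M0 : 0 < M by rewrite ltr_wpDl// addr_ge0.
have c0 : 0 < (2 * M)^-1 by rewrite invr_gt0 mulr_gt0.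
exists i, j, k, a, b, (2 * M)^-1, (Num.min 2^-1 `|(2 * M)^-1 * phi k x3|).
rewrite lt_min invr_gt0 ltr0n normr_gt0 mulf_neq0 ?(gt_eqF c0)//; split; first by [].
have small x : `|phi k x| <= M -> `|(2 * M)^-1 * phi k x| <= 2^-1.
  by move=> xM; rewrite normrM gtr0_norm// ler_pdivrMl ?mulr_gt0// mulrAC mulfV// mul1r.
have := small x1; have := small x2.
rewrite /combo E1 E2 -/w w0 add0r (mulrDr s) -expr2 s1 !ge_min lexx orbT.
have -> : `|phi k x1| <= M by rewrite /M -addrA lerDl addr_ge0.
have -> : `|phi k x2| <= M by rewrite /M [_ + `|phi k x2|]addrC -addrA lerDl addr_ge0.
move=> /(_ isT) h2 /(_ isT) h1; split => //; apply/orP; left.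
  by move: h1; rewrite ler_norml; lra.
have : `|s * ((2 * M)^-1 * phi k x2)| <= 2^-1 by rewrite normrM sn mul1r.
by rewrite ler_norml; lra.
Qed.

Let combo_dist i j k (a b c a' b' c' e : R) x :
  `|a' - a| <= e -> `|b' - b| <= e -> `|c' - c| <= e ->
  `|combo i j k a' b' c' x - combo i j k a b c x| <= 3 * e * (A * `|x|).
Proof.
move=> ha hb hc.
have -> : combo i j k a' b' c' x - combo i j k a b c x =
  (a' - a) * phi i x + (b' - b) * phi j x + (c' - c) * phi k x.
  by rewrite /combo; ring.
have term (r : R) n : `|r| <= e -> `|r * phi n x| <= e * (A * `|x|).
  by move=> re; rewrite normrM ler_pM.
have := term _ i ha; have := term _ j hb; have := term _ k hc.
move=> ? ? ?.
apply: le_trans (le_trans (ler_normD _ _) (lerD (ler_normD _ _) (lexx _))) _.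
lra.
Qed.

Let A_ge0 (x : X) : x != 0 -> 0 <= A.
Proof.
move=> x0; have := le_trans (normr_ge0 _) (phi_le 0 x).
by rewrite pmulr_lge0// normr_gt0.
Qed.

(** [functional] ignores the last component, so each functional occurs infinitely often in the
    enumeration. *)
Let index : Type := nat * nat * nat * rat * rat * rat * nat.

(** Dividing by the weight bounds all the combinations by the same [A]. *)
Let weight (a b c : R) := `|a| + `|b| + `|c| + 1.

Let weight_gt0 a b c : 0 < weight a b c.
Proof. by rewrite ltr_wpDl// !addr_ge0. Qed.

Let functional (t : index) : {scalar X} :=
  let: (i, j, k, a, b, c, _) := t in
  let w := weight (ratr a) (ratr b) (ratr c) in
  (ratr a / w \*o phi i) \+ (ratr b / w \*o phi j) \+ (ratr c / w \*o phi k).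

Let functionalE i j k a b c m x : functional (i, j, k, a, b, c, m) x =
  combo i j k (ratr a) (ratr b) (ratr c) x
    / weight (ratr a) (ratr b) (ratr c).
Proof. by rewrite /combo /=; field; rewrite gt_eqF. Qed.

Let functional_le t x : `|functional t x| <= A * `|x|.
Proof.
case: t => [[[[[[i j] k] a] b] c] m]; rewrite functionalE.
rewrite normrM normfV (gtr0_norm (weight_gt0 _ _ _)) ler_pdivrMr//.
have Ax : 0 <= A * `|x| := le_trans (normr_ge0 _) (phi_le 0 x).
have term (r : R) n : `|r * phi n x| <= `|r| * (A * `|x|).
  by rewrite normrM ler_wpM2l.
have := term (ratr a) i; have := term (ratr b) j; have := term (ratr c) k.
move=> ? ? ?.
apply: le_trans (le_trans (ler_normD _ _) (lerD (ler_normD _ _) (lexx _))) _.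
rewrite /weight; lra.
Qed.

Lemma direction_sequence : exists u : nat -> {scalar X},
  (forall n x, `|u n x| <= A * `|x|) /\
  forall x1 x2 x3 (s : R),
    (forall a b, a *: x1 + b *: x2 = 0 -> a = 0 /\ b = 0) -> x3 != 0 ->
    s ^+ 2 = 1 -> exists2 delta, 0 < delta & forall N, exists2 n, (N <= n)%N &
    [/\ delta <= u n x1, delta <= s * u n x2 & delta <= `|u n x3|].
Proof.
pose t0 : index := (0%N, 0%N, 0%N, 0, 0, 0, 0%N).
exists (fun n => functional (odflt t0 (unpickle n))); split => [n x|].
  exact: functional_le.
move=> x1 x2 x3 s indep x30 s1.
have [i [j [k [a [b [c [m [m0 [h1 h2 h3]]]]]]]]] := exists_combo indep x30 s1.
have A0 := A_ge0 x30.
pose B := A * (`|x1| + `|x2| + `|x3|) + 1.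
have B0 : 0 < B by rewrite ltr_wpDl// mulr_ge0// !addr_ge0.
(* With this tolerance on the three coefficients, [combo_dist] gives an error of at most [m / 2] at
   [x1], [x2] and [x3]. *)
have e0 : 0 < m / (6 * B) by rewrite divr_gt0// mulr_gt0.
have [a' ha] := rat_approx a e0; have [b' hb] := rat_approx b e0.
have [c' hc] := rat_approx c e0.
have near x : A * `|x| <= B ->
    `|combo i j k (ratr a') (ratr b') (ratr c') x - combo i j k a b c x| <= m / 2.
  move=> xB; apply: le_trans (combo_dist _ _ _ _ ha hb hc) _.
  have -> : m / 2 = 3 * (m / (6 * B)) * B by field; rewrite gt_eqF.
  by rewrite ler_wpM2l// mulr_ge0// ltW.
have n1 : 0 <= A * `|x1| by rewrite mulr_ge0.
have n2 : 0 <= A * `|x2| by rewrite mulr_ge0.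
have n3 : 0 <= A * `|x3| by rewrite mulr_ge0.
have B1 : A * `|x1| <= B by rewrite /B !mulrDr; lra.
have B2 : A * `|x2| <= B by rewrite /B !mulrDr; lra.
have B3 : A * `|x3| <= B by rewrite /B !mulrDr; lra.
have w0 := weight_gt0 (ratr a') (ratr b') (ratr c').
exists (m / 2 / weight (ratr a') (ratr b') (ratr c')).
  by rewrite !divr_gt0.
move=> N; pose f l := pickle ((i, j, k, a', b', c', l) : index).
have finj : injective f by move=> l l' /(pcan_inj pickleK)[].
have [l Nl] := injective_nat_unbounded finj N.
exists (f l) => //.
rewrite (_ : functional _ = functional (i, j, k, a', b', c', l)); last by rewrite pickleK.
rewrite !functionalE mulrA normrM normfV (gtr0_norm w0) !ler_pM2r ?invr_gt0//.
split.
- by have := near x1 B1; rewrite ler_norml; lra.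
- have sn := norm1_of_sqr s1.
  have := near x2 B2; rewrite -[leLHS]mul1r -{1}sn -normrM mulrBr ler_norml.
  by lra.
- have := near x3 B3; have := ler_normB (combo i j k (ratr a') (ratr b') (ratr c') x3)
    (combo i j k (ratr a') (ratr b') (ratr c') x3 - combo i j k a b c x3).
  by rewrite subKr; lra.
Qed.

End Directions.

(** * The final norm *)

Section GeometricSeries.
Context {R : realType}.
Implicit Types (u v : nat -> R).

(** A single summability condition for all the series below, stable under sums, scalar multiples and
    bounded factors. *)
Definition geo_bounded u := exists C, forall n, `|u n| <= C * 2^-1 ^+ n.

Definition sumR u : R := limn (series u).

Lemma half_exp_ge0 n : 0 <= 2^-1 ^+ n :> R.
Proof. by rewrite exprn_ge0. Qed.

Lemma quarter_exp_le_half n : 4^-1 ^+ n <= 2^-1 ^+ n :> R.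
Proof. by apply: lerXn2r; rewrite ?nnegrE; lra. Qed.

Lemma geo_bounded_cvg u : geo_bounded u -> cvgn (series u).
Proof.
move=> [C uC]; have C0 : 0 <= C.
  by have := le_trans (normr_ge0 _) (uC 0); rewrite expr0 mulr1.
apply: (@normed_cvg _ R^o); apply: (@series_le_cvg _ _ (geometric C 2^-1)) => //.
- by move=> n; exact: normr_ge0.
- by move=> n; exact: (mulr_ge0 C0 (half_exp_ge0 n)).
- by apply: is_cvg_geometric_series; rewrite ger0_norm// invf_lt1// ltr1n.
Qed.

Lemma geo_bounded_le u v :
  geo_bounded v -> (forall n, `|u n| <= `|v n|) -> geo_bounded u.
Proof. by move=> [C vC] uv; exists C => n; exact: le_trans (uv n) (vC n). Qed.

Lemma geo_bounded_norm u : geo_bounded u -> geo_bounded (fun n => `|u n|).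
Proof. by move=> gu; apply: geo_bounded_le gu _ => n; rewrite normr_id. Qed.

Lemma geo_boundedD u v :
  geo_bounded u -> geo_bounded v -> geo_bounded (fun n => u n + v n).
Proof.
move=> [C uC] [D vD]; exists (C + D) => n.
by rewrite (le_trans (ler_normD _ _))// mulrDl lerD.
Qed.

Lemma geo_boundedMl h u M : (forall n, `|h n| <= M) -> geo_bounded u ->
  geo_bounded (fun n => h n * u n).
Proof.
by move=> hM [C uC]; exists (M * C) => n; rewrite normrM -mulrA ler_pM.
Qed.

Lemma geo_boundedZ a u : geo_bounded u -> geo_bounded (fun n => a * u n).
Proof. exact: (@geo_boundedMl (fun=> a) _ `|a|). Qed.

Lemma sumR_le u v : geo_bounded u -> geo_bounded v ->
  (forall n, u n <= v n) -> sumR u <= sumR v.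
Proof. by move=> /geo_bounded_cvg cu /geo_bounded_cvg cv; exact: lim_series_le. Qed.

Lemma sumRD u v : geo_bounded u -> geo_bounded v ->
  sumR (fun n => u n + v n) = sumR u + sumR v.
Proof. by move=> /geo_bounded_cvg cu /geo_bounded_cvg cv; exact: lim_seriesD. Qed.

Lemma sumRZ a u : geo_bounded u -> sumR (fun n => a * u n) = a * sumR u.
Proof. by move=> /geo_bounded_cvg cu; exact: lim_seriesZ. Qed.

Lemma sumR_abs u : geo_bounded u -> `|sumR u| <= sumR (fun n => `|u n|).
Proof.
move=> gu; apply: (@lim_series_norm _ R^o).
exact: geo_bounded_cvg (geo_bounded_norm gu).
Qed.

Lemma geo_bounded_single k r : geo_bounded (fun n => if n == k then r else 0).
Proof.
exists (`|r| * 2 ^+ k) => n; case: eqP => [->|_].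
  by rewrite -mulrA -exprMn mulfV// expr1n mulr1.
by rewrite normr0 !mulr_ge0// ?exprn_ge0.
Qed.

Lemma sumR_single k r : sumR (fun n => if n == k then r else 0) = r.
Proof.
apply/cvg_lim => //; apply: cvg_near_cst; exists k.+1 => // n /= kn.
rewrite /series /= big_mkord (bigD1 (Ordinal kn))//= eqxx big1 ?addr0// => i.
by rewrite -val_eqE/= => /negPf ->.
Qed.

Lemma sumR0 : sumR (fun=> 0) = 0.
Proof.
have := sumR_single 0 0; congr (_ = _); congr sumR.
by apply/funext => n; case: ifP.
Qed.

Lemma geo_bounded0 : geo_bounded (fun=> 0).
Proof. by exists 0 => n; rewrite normr0 mul0r. Qed.

Lemma sumR_ge0 u : geo_bounded u -> (forall n, 0 <= u n) -> 0 <= sumR u.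
Proof. by move=> gu u0; rewrite -sumR0; apply: sumR_le => //; exact: geo_bounded0. Qed.

Lemma sumR_ge u k : geo_bounded u -> (forall n, 0 <= u n) -> u k <= sumR u.
Proof.
move=> gu u0; rewrite -[u k](sumR_single k); apply: sumR_le => // [|n].
  exact: geo_bounded_single.
by case: eqP => [->|].
Qed.

Lemma geo_bounded_sum (u : nat -> nat -> R) M :
  (forall m, geo_bounded (u m)) -> geo_bounded (fun n => \sum_(m < M) u m n).
Proof.
move=> gu; elim: M => [|M IH].
  by under eq_fun do rewrite big_ord0; exact: geo_bounded0.
by under eq_fun do rewrite big_ord_recr; exact: geo_boundedD.
Qed.

Lemma sumR_sum (u : nat -> nat -> R) M : (forall m, geo_bounded (u m)) ->
  sumR (fun n => \sum_(m < M) u m n) = \sum_(m < M) sumR (u m).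
Proof.
move=> gu; elim: M => [|M IH].
  by rewrite big_ord0; under eq_fun do rewrite big_ord0; exact: sumR0.
rewrite big_ord_recr/= -IH -sumRD//; last exact: geo_bounded_sum.
by congr sumR; apply/funext => n; rewrite big_ord_recr.
Qed.

End GeometricSeries.

(** * The norm [sum_n sqrt (a_n^2 + 64^-n q^2)] *)

Section SqrtNormSeries.
Context {R : realType} {V : lmodType R} (q : norm_on V) (a : nat -> {scalar V}).
Context (C : R) (a_le : forall n x, `|a n x| <= C * 4^-1 ^+ n * q x).

Let eps n : R := 8^-1 ^+ n.

Let eps_gt0 n : 0 < eps n. Proof. by rewrite exprn_gt0. Qed.

Let phi n x := a n x ^+ 2 + eps n ^+ 2 * q x ^+ 2.

Let phi_ge0 n x : 0 <= phi n x.
Proof. by rewrite addr_ge0 ?sqr_ge0// mulr_ge0 ?sqr_ge0. Qed.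

Let phiZ n b x : phi n (b *: x) = b ^+ 2 * phi n x.
Proof.
rewrite /phi linearZ/= norm_onZ !exprMn real_normK ?num_real//; ring.
Qed.

Let phi_convex n : convex (phi n).
Proof.
apply: convexD; last by apply: convexZ; [exact: sqr_ge0|exact: convex_sqr_norm].
move=> t x y /andP[t0 t1]; rewrite linearD !linearZ/=.
have : 0 <= t * (1 - t) * (a n x - a n y) ^+ 2.
  by rewrite mulr_ge0 ?sqr_ge0// mulr_ge0// subr_ge0.
lra.
Qed.

Let phi_lower n x : (eps n * q x) ^+ 2 <= phi n x.
Proof. by rewrite exprMn /phi lerDr sqr_ge0. Qed.

Let phi_eq0 n x : phi n x = 0 -> x = 0.
Proof.
move=> x0; apply: (@norm_on0_eq0 _ _ q); have := phi_lower n x; rewrite x0 => h.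
have : eps n * q x == 0 by rewrite -sqrf_eq0 eq_le h sqr_ge0.
by rewrite mulf_eq0 gt_eqF//= => /eqP.
Qed.

Let P n := sval (sqrt_norm_on (phi_ge0 n) (phiZ n) (phi_convex n) (@phi_eq0 n)).

Let PE n x : P n x = Num.sqrt (phi n x).
Proof. by rewrite /P; case: sqrt_norm_on. Qed.

Let P_lower n x : eps n * q x <= P n x.
Proof.
rewrite PE -[leLHS]ger0_norm ?mulr_ge0 ?norm_on_ge0 ?(ltW (eps_gt0 n))//.
by rewrite -sqrtr_sqr ler_wsqrtr.
Qed.

Let P_abs n x : `|a n x| <= P n x.
Proof. by rewrite PE -sqrtr_sqr ler_wsqrtr// /phi lerDl mulr_ge0 ?sqr_ge0. Qed.

Let P_upper_abs n x : P n x <= `|a n x| + eps n * q x.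
Proof.
have e0 : 0 <= eps n * q x by rewrite mulr_ge0 ?norm_on_ge0 ?(ltW (eps_gt0 n)).
rewrite PE -[leRHS]ger0_norm ?addr_ge0// -sqrtr_sqr ler_wsqrtr// /phi.
rewrite sqrrD real_normK ?num_real// -exprMn.
by rewrite -addrA lerD2l lerDr mulrn_wge0// mulr_ge0.
Qed.

Let eps_half n : eps n <= 2^-1 ^+ n.
Proof. by apply: lerXn2r; rewrite ?nnegrE; lra. Qed.

Let C_ge0 (x : V) : x != 0 -> 0 <= C.
Proof.
move=> x0; have := le_trans (normr_ge0 _) (a_le 0 x).
by rewrite expr0 mulr1 pmulr_lge0// norm_on_gt0.
Qed.

Let P_upper n x : P n x <= (`|C| + 1) * q x * 2^-1 ^+ n.
Proof.
apply: le_trans (P_upper_abs n x) _.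
have q0 := norm_on_ge0 q x.
have h1 : C * 4^-1 ^+ n * q x <= `|C| * 2^-1 ^+ n * q x.
  rewrite ler_wpM2r//; apply: le_trans (ler_wpM2r _ (ler_norm C)) _.
    by rewrite exprn_ge0.
  by rewrite ler_wpM2l// quarter_exp_le_half.
have h2 := ler_wpM2r q0 (eps_half n).
have := a_le n x; lra.
Qed.

Let P_geo x : geo_bounded (fun n => P n x).
Proof.
by exists ((`|C| + 1) * q x) => n; rewrite ger0_norm ?norm_on_ge0// P_upper.
Qed.

Let p x := sumR (fun n => P n x).

Let pD x y : p (x + y) <= p x + p y.
Proof.
rewrite /p -sumRD//; apply: sumR_le => // [|n]; first exact: geo_boundedD.
exact: norm_onD.
Qed.

Let pZ b x : p (b *: x) = `|b| * p x.
Proof. by rewrite /p -sumRZ//; congr sumR; apply/funext => n; exact: norm_onZ. Qed.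

Let q_le_p x : q x <= p x.
Proof.
have := sumR_ge 0 (P_geo x) (fun n => norm_on_ge0 (P n) x); apply: le_trans.
by have := P_lower 0 x; rewrite /eps expr0 mul1r.
Qed.

Let p_eq0 x : p x = 0 -> x = 0.
Proof.
move=> x0; apply: (@norm_on0_eq0 _ _ q); apply/eqP.
by rewrite eq_le norm_on_ge0 -x0 q_le_p.
Qed.

Let geo : geo_bounded (fun n => 2^-1 ^+ n : R).
Proof. by exists 1 => n; rewrite mul1r ger0_norm// half_exp_ge0. Qed.

Let p_le x : p x <= (`|C| + 1) * sumR (fun n => 2^-1 ^+ n) * q x.
Proof.
have -> : (`|C| + 1) * sumR (fun n => 2^-1 ^+ n) * q x =
  sumR (fun n => (`|C| + 1) * q x * 2^-1 ^+ n).
  by rewrite sumRZ// mulrAC.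
by apply: sumR_le => //; exact: geo_boundedZ.
Qed.

(** The graph of the square root lies below its tangents: with [s], [t] the roots of [A], [B], the
    gap is the nonnegative number [(t - s) ^+ 2 / (2 * s)]. *)
Let sqrt_tangent (A B : R) : 0 < A -> 0 <= B ->
  Num.sqrt B <= Num.sqrt A + (B - A) / (2 * Num.sqrt A).
Proof.
move=> A0 B0; have sA : 0 < Num.sqrt A by rewrite sqrtr_gt0.
rewrite -{2}(sqr_sqrtr B0) -{2}(sqr_sqrtr (ltW A0)).
move: (Num.sqrt A) (Num.sqrt B) sA => s t s0.
have -> : s + (t ^+ 2 - s ^+ 2) / (2 * s) = t + (t - s) ^+ 2 / (2 * s).
  by field; rewrite gt_eqF.
by rewrite lerDl divr_ge0 ?sqr_ge0// mulr_ge0// ltW.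
Qed.

(** This is the partial derivative of [sqrt (a ^+ 2 + eps n ^+ 2 * q x ^+ 2)] in the variable [a],
    at [a = a n x]. *)
Let coef n x := a n x / P n x.

Let coef_le1 n x : `|coef n x| <= 1.
Proof.
have [->|x0] := eqVneq x 0; first by rewrite /coef raddf0 mul0r normr0.
by rewrite normrM normfV (gtr0_norm (norm_on_gt0 _ x0)) ler_pdivrMr ?norm_on_gt0// mul1r.
Qed.

Let a_geo x : geo_bounded (fun n => a n x).
Proof. by apply: geo_bounded_le (P_geo x) _ => n; rewrite (ger0_norm (norm_on_ge0 _ _)). Qed.

(** The tangent inequality at [phi n x] is summed over [n]. The increment of [phi n] divided by
    [2 * P n x] has a part linear in [s] (with [coef]), a quadratic part (with [b], giving [E]) and
    a multiple of the increment of the square of [q] (with [w], giving [kappa]). *)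
Let p_tangent (x : V) : x != 0 -> exists2 kappa, 0 <= kappa & forall y, exists E, forall s,
  p (x + s *: y) <= p x + s * sumR (fun n => coef n x * a n y) + s ^+ 2 * E +
    kappa * (q (x + s *: y) ^+ 2 - q x ^+ 2).
Proof.
move=> x0; have q0 := norm_on_gt0 q x0.
have P0 n : 0 < P n x by exact: norm_on_gt0.
have C0 := C_ge0 x0.
pose w n := eps n ^+ 2 / (2 * P n x).
have w_ge0 n : 0 <= w n by rewrite divr_ge0 ?sqr_ge0// mulr_ge0// ltW.
have w_geo : geo_bounded w.
  exists (q x)^-1 => n; rewrite ger0_norm// ler_pdivrMr ?mulr_gt0//.
  have h1 := ler_wpM2l (ltW (eps_gt0 n)) (eps_half n).
  have h2 : eps n <= 2 * P n x / q x.
    by rewrite ler_pdivlMr//; have := P_lower n x; have := P0 n; lra.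
  rewrite expr2 (le_trans h1)//.
  have -> : (q x)^-1 * 2^-1 ^+ n * (2 * P n x) = 2 * P n x / q x * 2^-1 ^+ n.
    by rewrite mulrC mulrA.
  by rewrite ler_wpM2r ?half_exp_ge0.
exists (sumR w); first exact: sumR_ge0.
move=> y; pose b n := a n y ^+ 2 / (2 * P n x).
have b_geo : geo_bounded b.
  exists (C ^+ 2 * q y ^+ 2 / q x) => n.
  rewrite ger0_norm ?divr_ge0 ?sqr_ge0 ?mulr_ge0 ?(ltW (P0 n))//.
  rewrite ler_pdivrMr ?mulr_gt0//.
  have h1 : a n y ^+ 2 <= (C * 4^-1 ^+ n * q y) ^+ 2.
    by rewrite -[leLHS]real_normK ?num_real// ler_pXn2r ?nnegrE ?(le_trans (normr_ge0 _) (a_le n y)).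
  apply: le_trans h1 _.
  (* Since [16^-n] is [2^-n] times [8^-n], the factor [8^-n] can be spent on the bound of [P n x]
     from below by [eps n * q x]. *)
  have -> : (C * 4^-1 ^+ n * q y) ^+ 2 =
      C ^+ 2 * q y ^+ 2 / q x * 2^-1 ^+ n * (eps n * q x).
    have -> : (4^-1 : R) ^+ n = 2^-1 ^+ n * 2^-1 ^+ n.
      by rewrite -exprMn; congr (_ ^+ _); field.
    have -> : eps n = 2^-1 ^+ n * 2^-1 ^+ n * 2^-1 ^+ n.
      by rewrite -!exprMn; congr (_ ^+ _); field.
    by field; rewrite gt_eqF.
  apply: ler_wpM2l.
    by rewrite mulr_ge0 ?half_exp_ge0// divr_ge0 ?(ltW q0)// mulr_ge0 ?sqr_ge0.
  by have := P_lower n x; have := P0 n; lra.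
exists (sumR b) => s.
have c_geo : geo_bounded (fun n => coef n x * a n y).
  exact: geo_boundedMl (coef_le1 ^~ x) (a_geo y).
set r := q _ ^+ 2 - _.
have -> : p x + s * sumR (fun n => coef n x * a n y) + s ^+ 2 * sumR b +
    sumR w * r = sumR (fun n => P n x + s * (coef n x * a n y) + s ^+ 2 * b n + r * w n).
  have g1 := geo_boundedZ s c_geo.
  have g2 := geo_boundedZ (s ^+ 2) b_geo.
  have g3 := geo_boundedZ r w_geo.
  have g4 := geo_boundedD (P_geo x) g1.
  have g5 := geo_boundedD g4 g2.
  by rewrite (sumRD g5 g3) (sumRD g4 g2) (sumRD (P_geo x) g1) !sumRZ// (mulrC r).
apply: sumR_le => // [|n].
  do 3 (apply: geo_boundedD; last exact: geo_boundedZ); exact: P_geo.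
have phi0 : 0 < phi n x by rewrite -sqrtr_gt0 -PE.
have := sqrt_tangent phi0 (phi_ge0 n (x + s *: y)).
rewrite -!PE => /le_trans; apply.
rewrite /phi /coef /b /w /r linearD linearZ/= le_eqVlt; apply/orP; left; apply/eqP.
by field; rewrite gt_eqF.
Qed.

(* The terms [eps n * q] remove the kinks of [`|a n|] (in the directions where
   [q] is smooth), while being negligible compared with [a n]. *)
Lemma sqrt_norm_series : exists (p : norm_on V) (coef : nat -> V -> R) (M : R),
  [/\ 0 < M /\ forall x, q x <= p x <= M * q x,
      forall n x, `|coef n x| <= 1,
      forall n (x : V) s, x != 0 -> s ^+ 2 = 1 -> 0 < s * a n x ->
        1 - s * coef n x <= 8^-1 ^+ n * q x / (s * a n x) &
      forall x : V, x != 0 -> exists2 kappa, 0 <= kappa &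
        forall y, exists E, forall s,
          p (x + s *: y) <= p x + s * sumR (fun n => coef n x * a n y) +
            s ^+ 2 * E + kappa * (q (x + s *: y) ^+ 2 - q x ^+ 2)].
Proof.
exists (NormOn pD pZ p_eq0), coef, ((`|C| + 1) * sumR (fun n => 2^-1 ^+ n)).
split => //.
- split=> [|x]; last by rewrite /= q_le_p p_le.
  rewrite mulr_gt0 ?ltr_wpDl// (lt_le_trans ltr01)//.
  by have := sumR_ge 0 geo half_exp_ge0; rewrite expr0.
- move=> n x s x0 s1 sa.
  have P0 : 0 < P n x by exact: norm_on_gt0.
  have sn := norm1_of_sqr s1.
  have aE : s * a n x = `|a n x| by rewrite -(gtr0_norm sa) normrM sn mul1r.
  rewrite /coef mulrA aE; rewrite aE in sa.
  have := P_upper_abs n x; have := P_abs n x.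
  move: (`|a n x|) (eps n * q x) (P n x) P0 sa => b t r r0 b0 br rt.
  have -> : 1 - b / r = (r - b) / r by field; rewrite gt_eqF.
  rewrite ler_pdivrMr// mulrAC ler_pdivlMr//.
  have h1 : 0 <= (t - (r - b)) * r by rewrite mulr_ge0 ?(ltW r0)// subr_ge0 lerBlDl.
  have h2 : 0 <= (r - b) * (r - b) by rewrite -expr2 sqr_ge0.
  lra.
Qed.

End SqrtNormSeries.

(** * Linear relations between support functionals *)

Section NonlineableNorm.
Context {R : realType}.

(** Test [s = r * t] with [r] so small that [M * r] is at most 1/2. *)
Lemma quadratic_bound_eq0 (t M c : R) : 0 < c ->
  (forall s, `|s| <= c -> s * t <= M * s ^+ 2) -> t = 0.
Proof.
move=> c0 h; apply/eqP/negPn/negP => t0.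
have nt0 : 0 < `|t| by rewrite normr_gt0.
have M0 : 0 < 2 * (`|M| + 1) by rewrite mulr_gt0// ltr_wpDl.
pose r := Num.min (c / `|t|) (2 * (`|M| + 1))^-1.
have r0 : 0 < r by rewrite lt_min divr_gt0// invr_gt0.
have rc : r <= c / `|t| by rewrite ge_min lexx.
have rM : r <= (2 * (`|M| + 1))^-1 by rewrite ge_min lexx orbT.
have := h (r * t); rewrite normrM (gtr0_norm r0) -ler_pdivlMr// => /(_ rc).
have -> : r * t * t = r * t ^+ 2 by rewrite -mulrA.
have -> : M * (r * t) ^+ 2 = r * t ^+ 2 * (M * r) by ring.
have rt0 : 0 < r * t ^+ 2 by rewrite mulr_gt0// exprn_even_gt0.
rewrite ler_pMr// => h1.
have : `|M| * r <= (`|M| + 1) * (2 * (`|M| + 1))^-1.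
  by rewrite ler_pM// ?(ltW r0)// lerDl.
have -> : (`|M| + 1) * (2 * (`|M| + 1))^-1 = 2^-1.
  by rewrite invfM mulrCA mulfV ?mulr1// gt_eqF// ltr_wpDl.
have := ler_wpM2r (ltW r0) (ler_norm M); lra.
Qed.

Lemma strict_subsequence (d : nat -> R) (b : nat -> R) :
  d m @[m --> \oo] --> (0 : R) -> (forall n, 0 < b n) ->
  exists A : nat -> nat, [/\ injective A, forall n, (n <= A n)%N &
    forall n, `|d (A n)| <= b n].
Proof.
move=> d0 b0.
have /choice[N NP] n : exists N, forall m, (N <= m)%N -> `|d m| <= b n.
  have /cvgrPdist_lt /(_ _ (b0 n)) [N _ hN] := d0.
  by exists N => m /hN /=; rewrite sub0r normrN => /ltW.
(* The sum includes [N n], so [A n] is at least [N n]; the summand [n] makes [A] strictly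
   increasing. *)
pose A n := (n + \sum_(i < n.+1) N i)%N.
have Amono m n : (m < n)%N -> (A m < A n)%N.
  move=> mn; rewrite /A -addSn leq_add//.
  rewrite -!(big_mkord xpredT N) [leqRHS](big_cat_nat _ (n := m.+1))//=; last first.
    by rewrite ltnS ltnW.
  exact: leq_addr.
exists A; split.
- move=> m n Amn; case: (ltngtP m n) => // /Amono; rewrite Amn ltnn//.
- by move=> n; exact: leq_addr.
- move=> n; apply: NP; rewrite /A big_ord_recr/= addnA; exact: leq_addl.
Qed.

(** Here [a], [b], [c] stand for the values of [coef] at [x1], [x2], [x3]. Letting [eta] tend to 0,
    this lemma and the next yield [s1 + s2 <= s3] and [s3 <= |s1 - s2|], which are incompatible for
    positive [s1], [s2]. *)
Lemma same_sign_le (s1 s2 s3 eta a b c : R) : 0 <= s1 -> 0 <= s2 -> 0 <= s3 ->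
  0 <= eta -> `|s3 * c - (s1 * a + s2 * b)| <= eta ->
  1 - eta <= a -> 1 - eta <= b -> c <= 1 ->
  s1 + s2 <= s3 + eta * (s1 + s2 + s3 + 1).
Proof.
move=> s10 s20 s30 eta0; rewrite ler_norml => /andP[h _] a1 b1 c1.
have := ler_wpM2l s10 a1; have := ler_wpM2l s20 b1; have := ler_wpM2l s30 c1.
by have := mulr_ge0 eta0 s30; lra.
Qed.

Lemma opposite_sign_le (s1 s2 s3 eta a b c : R) :
  0 <= s1 -> 0 <= s2 -> 0 <= s3 ->
  `|s3 * c - (s1 * a + s2 * b)| <= eta ->
  1 - eta <= a -> a <= 1 -> 1 - eta <= - b -> -1 <= b -> 1 - eta <= `|c| ->
  s3 <= `|s1 - s2| + eta * (s1 + s2 + s3 + 1).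
Proof.
move=> s10 s20 s30 h a1 a2 b1 b2 c1.
have ab : `|s1 * a + s2 * b| <= `|s1 - s2| + eta * (s1 + s2).
  have : `|s1 * (a - 1) + s2 * (b + 1)| <= eta * (s1 + s2).
    have := ler_wpM2l s10 a1; have := ler_wpM2l s10 a2.
    have := ler_wpM2l s20 b1; have := ler_wpM2l s20 b2.
    move=> ? ? ? ?; rewrite ler_norml; apply/andP; split; lra.
  have := ler_normD (s1 - s2) (s1 * (a - 1) + s2 * (b + 1)).
  have -> : s1 - s2 + (s1 * (a - 1) + s2 * (b + 1)) = s1 * a + s2 * b by ring.
  lra.
have : s3 * `|c| <= eta + `|s1 * a + s2 * b|.
  rewrite -[s3 in leLHS]ger0_norm// -normrM.
  have := ler_normD (s3 * c - (s1 * a + s2 * b)) (s1 * a + s2 * b).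
  by rewrite subrK; lra.
have := ler_wpM2l s30 c1; lra.
Qed.

(** These are the subgradients of [p] at [x]; for nonzero [x], they are the functionals of dual norm
    1 that attain it at the normalized [x]. *)
Definition supports {V : lmodType R} (p : norm_on V) (f : {scalar V}) (x : V) :=
  (forall y, f y <= p y) /\ f x = p x.

Context {V : lmodType R} (q : norm_on V).
Context (e : nat -> V) (psi u : nat -> {scalar V}) (K B : R) (d : nat -> V).
Context (K_gt0 : 0 < K)
  (psi_le : forall n x, `|psi n x| <= K * q x)
  (u_le : forall n x, `|u n x| <= K * q x)
  (psie : forall n m, psi n (e m) = (n == m)%:R)
  (u_sum : forall n M, \sum_(m < M) `|u n (e m)| <= B)
  (u_dir : forall x1 x2 x3 (s : R),
    (forall a b, a *: x1 + b *: x2 = 0 -> a = 0 /\ b = 0) -> x3 != 0 ->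
    s ^+ 2 = 1 -> exists2 delta, 0 < delta & forall N, exists2 n, (N <= n)%N &
    [/\ delta <= u n x1, delta <= s * u n x2 & delta <= `|u n x3|])
  (q_flat : forall x, exists n0 c E, 0 < c /\ forall n s, (n0 <= n)%N ->
    `|s| <= c -> q (x + s *: e n) ^+ 2 - q x ^+ 2 <= E * s ^+ 2)
  (q_smooth : forall x i, exists C, forall s,
     q (x + s *: d i) ^+ 2 + q (x - s *: d i) ^+ 2 <= 2 * q x ^+ 2 + C * s ^+ 2).

Let quarter_ge0 n : 0 <= 4^-1 ^+ n :> R. Proof. by rewrite exprn_ge0. Qed.

Let dd m := sumR (fun n => 4^-1 ^+ n * `|u n (e m)|).

Let quarter_geo : geo_bounded (fun n => 4^-1 ^+ n : R).
Proof. by exists 1 => n; rewrite mul1r ger0_norm// quarter_exp_le_half. Qed.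

Let dd_geo x : geo_bounded (fun n => 4^-1 ^+ n * `|u n x|).
Proof.
under eq_fun do rewrite mulrC.
by apply: (@geo_boundedMl _ _ _ (K * q x)) => // n; rewrite normr_id.
Qed.

(** Exchanging the sums over [m] and [n] and using [u_sum] bounds the partial sums of [dd], so the
    series converges and its terms tend to 0. *)
Let dd_cvg0 : dd m @[m --> \oo] --> (0 : R).
Proof.
apply: (@cvg_series_cvg_0 _ R^o); apply: nondecreasing_is_cvgn.
  apply: nondecreasing_series => m _ _; apply: sumR_ge0 => [|n].
    exact: dd_geo.
  by rewrite mulr_ge0.
exists (sumR (fun n => B * 4^-1 ^+ n)) => _ [M _ <-].
rewrite /series/= big_mkord -[leLHS](sumR_sum M (fun m => dd_geo (e m))).
apply: sumR_le => [||n].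
- exact: (geo_bounded_sum _ (fun m => dd_geo (e m))).
- exact: geo_boundedZ.
- by rewrite -mulr_sumr mulrC ler_wpM2r.
Qed.

Lemma nonlineable_norm : exists (p : norm_on V) (M : R),
  [/\ 0 < M /\ forall x, q x <= p x <= M * q x,
      forall f1 f2 x, x != 0 -> supports p f1 x -> supports p f2 x ->
        forall i, f1 (d i) = f2 (d i) &
      forall f1 f2 f3 x1 x2 x3 (s1 s2 s3 : R), x1 != 0 -> x2 != 0 -> x3 != 0 ->
        supports p f1 x1 -> supports p f2 x2 -> supports p f3 x3 ->
        0 < s1 -> 0 < s2 -> 0 < s3 ->
        (forall y, s3 * f3 y = s1 * f1 y + s2 * f2 y) ->
        ~ (forall a b, a *: x1 + b *: x2 = 0 -> a = 0 /\ b = 0)].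
Proof.
have b0 n : 0 < 16^-1 ^+ n :> R by rewrite exprn_gt0.
have [A [Ainj Age Ad]] := strict_subsequence dd_cvg0 b0.
pose a n : {scalar V} := 4^-1 ^+ n \*o (u n \+ (2^-1 ^+ n \*o psi (A n))).
have aE n x : a n x = 4^-1 ^+ n * (u n x + 2^-1 ^+ n * psi (A n) x) by [].
have a_le n x : `|a n x| <= 2 * K * 4^-1 ^+ n * q x.
  rewrite aE normrM (ger0_norm (quarter_ge0 n)) mulrAC [leRHS]mulrC ler_wpM2l//.
  apply: le_trans (ler_normD _ _) _.
  have : `|2^-1 ^+ n * psi (A n) x| <= K * q x.
    rewrite normrM ger0_norm ?half_exp_ge0// (le_trans _ (psi_le (A n) x))//.
    by rewrite ler_piMl// exprn_ile1//; lra.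
  by have := u_le n x; lra.
have [p [coef [M [[M0 pM] coef1 coef_near p_tan]]]] := sqrt_norm_series a_le.
exists p, M; split=> //.
  (* Smoothness along [d i]: test [f1] at [x + s *: d i] and [f2] at [x - s *: d i]. In the sum of
     the two tangent inequalities the linear terms cancel and [q_smooth] leaves a quadratic
     bound. *)
  move=> f1 f2 x x0 [f1p f1x] [f2p f2x] i.
  have [kappa k0 /(_ (d i))[E hE]] := p_tan x x0.
  have [C hC] := q_smooth x i.
  apply/eqP; rewrite -subr_eq0; apply/eqP.
  apply: (@quadratic_bound_eq0 _ (2 * E + kappa * C) 1) => // s _.
  have := hE s; have := hE (- s); have := ler_wpM2l k0 (hC s).
  have := f1p (x + s *: d i); have := f2p (x - s *: d i).
  have -> : f1 (x + s *: d i) = p x + s * f1 (d i) by rewrite linearD linearZ/= f1x.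
  have -> : f2 (x - s *: d i) = p x - s * f2 (d i) by rewrite linearB linearZ/= f2x.
  by rewrite sqrrN scaleNr; lra.
(* Along [e m] with [m] large, [q_flat] turns the [kappa] term into a quadratic one, so the linear
   part of the tangent inequality determines [f (e m)]. *)
have key f x : x != 0 -> supports p f x -> exists N, forall m, (N <= m)%N ->
    f (e m) = sumR (fun n => coef n x * a n (e m)).
  move=> x0 [fp fx].
  have [kappa k0 hk] := p_tan x x0.
  have [n0 [c [C [c0 hc]]]] := q_flat x.
  exists n0 => m n0m; have [E hE] := hk (e m).
  apply/eqP; rewrite -subr_eq0; apply/eqP.
  apply: (@quadratic_bound_eq0 _ (E + kappa * C) c) => // s sc.
  have := hE s; have := ler_wpM2l k0 (hc m s n0m sc).
  have -> : s * (f (e m) - sumR (fun n => coef n x * a n (e m))) =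
      f (x + s *: e m) - p x - s * sumR (fun n => coef n x * a n (e m)).
    by rewrite linearD linearZ/= fx; ring.
  by have := fp (x + s *: e m); lra.
have near x (delta eta : R) : x != 0 -> 0 < delta -> 0 < eta ->
    exists N, forall k s, (N <= k)%N -> s ^+ 2 = 1 -> delta <= s * u k x ->
    1 - eta <= s * coef k x.
  move=> x0 del0 eta0.
  (* Once [2^-k * L < 1], the first summand makes the [psi] part of [a k] at most half of the [u]
     part, and the second makes the defect of [coef] at most [eta]. *)
  pose L := 2 * K * q x / delta + 2 * q x / (delta * eta).
  have q0 := norm_on_gt0 q x0.
  have half_cvg : 2^-1 ^+ n @[n --> \oo] --> (0 : R).
    by apply: cvg_expr; rewrite ger0_norm// invf_lt1// ltr1n.
  have L0 : 0 < L by rewrite addr_gt0// !mulr_gt0// ?invr_gt0// mulr_gt0.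
  have Linv : 0 < L^-1 by rewrite invr_gt0.
  have /cvgrPdist_lt /(_ _ Linv) [N _ hN] := half_cvg.
  exists N => k s /hN /=; rewrite sub0r normrN ger0_norm ?half_exp_ge0// => kL.
  move=> s1 del_u.
  have sn := norm1_of_sqr s1.
  have {}kL : 2^-1 ^+ k * L < 1 by rewrite -ltr_pdivlMr// div1r.
  have h0 := half_exp_ge0 (R := R) k.
  have k1 : 2^-1 ^+ k * (2 * K * q x) <= delta.
    have : 2^-1 ^+ k * (2 * K * q x / delta) <= 1.
      apply: le_trans (ltW kL); rewrite ler_wpM2l// lerDl.
      by rewrite divr_ge0 ?mulr_ge0 ?norm_on_ge0// ltW.
    by rewrite mulrA ler_pdivrMr// mul1r.
  have k2 : 2^-1 ^+ k * (2 * q x) <= delta * eta.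
    have : 2^-1 ^+ k * (2 * q x / (delta * eta)) <= 1.
      apply: le_trans (ltW kL); rewrite ler_wpM2l// lerDr.
      by rewrite divr_ge0 ?mulr_ge0 ?norm_on_ge0// ltW.
    by rewrite mulrA ler_pdivrMr ?mulr_gt0// mul1r.
  have sa : 4^-1 ^+ k * (delta / 2) <= s * a k x.
    rewrite aE [leRHS]mulrCA ler_wpM2l// mulrDr.
    have : `|s * (2^-1 ^+ k * psi (A k) x)| <= 2^-1 ^+ k * (K * q x).
      by rewrite normrM sn mul1r normrM (ger0_norm h0) ler_wpM2l.
    by rewrite ler_norml; lra.
  have q4 : 0 < 4^-1 ^+ k * (delta / 2) by rewrite mulr_gt0 ?divr_gt0// exprn_gt0.
  have sa0 := lt_le_trans q4 sa.
  have := coef_near k x s x0 s1 sa0.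
  suff : 8^-1 ^+ k * q x / (s * a k x) <= eta by lra.
  rewrite ler_pdivrMr// mulrC; apply: le_trans (ler_wpM2l (ltW eta0) sa).
  have -> : (8^-1 : R) ^+ k = 4^-1 ^+ k * 2^-1 ^+ k.
    by rewrite -exprMn; congr (_ ^+ _); field.
  have := ler_wpM2l (quarter_ge0 k) k2; lra.
move=> f1 f2 f3 x1 x2 x3 s1 s2 s3 x10 x20 x30 sf1 sf2 sf3 s10 s20 s30 fE indep.
have [N1 H1] := key _ _ x10 sf1; have [N2 H2] := key _ _ x20 sf2.
have [N3 H3] := key _ _ x30 sf3.
pose h n := s3 * coef n x3 - (s1 * coef n x1 + s2 * coef n x2).
pose H := s3 + (s1 + s2).
have H0 : 0 < H by rewrite !addr_gt0.
have hH n : `|h n| <= H.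
  have term (r : R) x : 0 < r -> `|r * coef n x| <= r.
    by move=> r0; rewrite normrM gtr0_norm// ler_piMr// ltW.
  apply: le_trans (ler_normB _ _) _; apply: lerD; first exact: term.
  by apply: le_trans (ler_normD _ _) _; apply: lerD; exact: term.
have a_geo x : geo_bounded (fun n => a n x).
  apply: (@geo_bounded_le _ _ (fun n => (2 * K * q x) * 4^-1 ^+ n)).
    exact: geo_boundedZ.
  move=> n; apply: le_trans (a_le n x) _; rewrite mulrAC ler_norm//.
have sum0 m : (N1 <= m)%N -> (N2 <= m)%N -> (N3 <= m)%N ->
    sumR (fun n => h n * a n (e m)) = 0.
  move=> m1 m2 m3; have := fE (e m); rewrite H1// H2// H3// => E.
  have g x : geo_bounded (fun n => coef n x * a n (e m)).
    exact: geo_boundedMl (coef1 ^~ x) (a_geo (e m)).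
  have g1 := geo_boundedZ s1 (g x1).
  have g2 := geo_boundedZ s2 (g x2).
  have g3 := geo_boundedZ s3 (g x3).
  have g12 := geo_boundedZ (-1) (geo_boundedD g1 g2).
  have -> : sumR (fun n => h n * a n (e m)) =
      sumR (fun n => s3 * (coef n x3 * a n (e m)) +
        -1 * (s1 * (coef n x1 * a n (e m)) + s2 * (coef n x2 * a n (e m)))).
    by congr sumR; apply/funext => n; rewrite /h; ring.
  rewrite (sumRD g3 g12) (sumRZ _ (geo_boundedD g1 g2)) (sumRD g1 g2) !sumRZ//.
  by rewrite E mulN1r subrr.
pose N0 := maxn N1 (maxn N2 N3).
(* Test the relation on [e (A k)]: as [A] is injective, the [psi] parts contribute only
   [h k * 8^-k], whereas the [u] parts contribute at most [H * dd (A k)], which is at most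
   [H * 16^-k]. *)
have h_small k : (N0 <= k)%N -> `|h k| <= H * 2^-1 ^+ k.
  rewrite !geq_max => /and3P[k1 k2 k3].
  have Ak := Age k.
  have := sum0 (A k) (leq_trans k1 Ak) (leq_trans k2 Ak) (leq_trans k3 Ak).
  have gu : geo_bounded (fun n => h n * (4^-1 ^+ n * u n (e (A k)))).
    apply: geo_boundedMl hH _; apply: geo_bounded_le (dd_geo (e (A k))) _ => n.
    by rewrite !normrM normr_id.
  have -> : sumR (fun n => h n * a n (e (A k))) =
      sumR (fun n => h n * (4^-1 ^+ n * u n (e (A k)))) + h k * 8^-1 ^+ k.
    rewrite -[h k * _](sumR_single k) -sumRD//; last exact: geo_bounded_single.
    congr sumR; apply/funext => n; rewrite aE psie (inj_eq Ainj).
    have -> : (8^-1 : R) ^+ k = 4^-1 ^+ k * 2^-1 ^+ k.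
      by rewrite -exprMn; congr (_ ^+ _); field.
    by have [->|_] := eqVneq n k; rewrite ?mulr1n ?mulr0n; ring.
  move/eqP; rewrite addr_eq0 => /eqP /(congr1 Num.norm); rewrite normrN normrM.
  rewrite [in X in _ = X](ger0_norm (exprn_ge0 _ _))// => hE.
  have : `|h k| * 8^-1 ^+ k <= H * 16^-1 ^+ k.
    rewrite -hE (le_trans (sumR_abs gu))//.
    have h1 : sumR (fun n => `|h n * (4^-1 ^+ n * u n (e (A k)))|) <= H * dd (A k).
      rewrite /dd -sumRZ//; apply: sumR_le.
      - exact: geo_bounded_norm.
      - exact: geo_boundedZ.
      - move=> n; rewrite normrM ler_pM// normrM ger0_norm//.
    apply: le_trans h1 _; rewrite ler_wpM2l ?(ltW H0)//.
    exact: le_trans (ler_norm _) (Ad k).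
  have -> : (16^-1 : R) ^+ k = 2^-1 ^+ k * 8^-1 ^+ k.
    by rewrite -exprMn; congr (_ ^+ _); field.
  by rewrite mulrA ler_pM2r// exprn_gt0.
(* [s = 1] selects an index where [x1] and [x2] have equal signs, and [s = -1] one where the signs
   are opposite. *)
have pattern (s : R) (eta : R) : s ^+ 2 = 1 -> 0 < eta -> exists k,
    [/\ `|h k| <= eta, 1 - eta <= coef k x1, 1 - eta <= s * coef k x2
      & 1 - eta <= `|coef k x3|].
  move=> ss eta0; have [delta del0 hdel] := u_dir indep x30 ss.
  have [M1 HM1] := near _ _ _ x10 del0 eta0.
  have [M2 HM2] := near _ _ _ x20 del0 eta0.
  have [M3 HM3] := near _ _ _ x30 del0 eta0.
  have half_cvg : 2^-1 ^+ n @[n --> \oo] --> (0 : R).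
    by apply: cvg_expr; rewrite ger0_norm// invf_lt1// ltr1n.
  have /cvgrPdist_lt /(_ _ (divr_gt0 eta0 H0)) [M4 _ HM4] := half_cvg.
  have [k kN [d1 d2 d3]] := hdel (maxn N0 (maxn M1 (maxn M2 (maxn M3 M4)))).
  move: kN; rewrite geq_max => /andP[kN]; rewrite !geq_max => /and4P[k1 k2 k3 k4].
  exists k; split.
  - apply: le_trans (h_small k kN) _.
    have := HM4 k k4; rewrite /= sub0r normrN ger0_norm ?half_exp_ge0//.
    by rewrite ltr_pdivlMr// mulrC => /ltW.
  - by rewrite -[coef k x1]mul1r; apply: HM1; rewrite ?expr1n ?mul1r.
  - exact: HM2.
  - have u30 : u k x3 != 0 by rewrite -normr_gt0 (lt_le_trans del0).
    have := HM3 k (Num.sg (u k x3)) k3; rewrite sqr_sg u30 => /(_ erefl).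
    rewrite -normrEsg => /(_ d3) /le_trans; apply.
    by rewrite (le_trans (ler_norm _))// normrM normr_sg u30 mul1r.
have coefl n x : -1 <= coef n x <= 1 by rewrite -ler_norml.
have D0 : 0 < s1 + s2 + s3 + 1 by rewrite !addr_gt0.
have ge12 : s1 + s2 <= s3.
  apply/ler_addgt0Pr => eps eps0; have eta0 := divr_gt0 eps0 D0.
  have [k [hk c1 c2 _]] := pattern 1 _ (expr1n _ _) eta0.
  rewrite mul1r in c2; have /andP[_ c3] := coefl k x3.
  have := same_sign_le (ltW s10) (ltW s20) (ltW s30) (ltW eta0) hk c1 c2 c3.
  by rewrite divfK// gt_eqF.
have : s3 <= `|s1 - s2|.
  apply/ler_addgt0Pr => eps eps0; have eta0 := divr_gt0 eps0 D0.
  have ss : (-1 : R) ^+ 2 = 1 by rewrite sqrrN expr1n.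
  have [k [hk c1 c2 c3]] := pattern (-1) _ ss eta0.
  have /andP[_ c1'] := coefl k x1; have /andP[c2' _] := coefl k x2.
  rewrite mulN1r in c2.
  have := opposite_sign_le (ltW s10) (ltW s20) (ltW s30) hk c1 c1' c2 c2' c3.
  by rewrite divfK// gt_eqF.
move=> /(le_trans ge12); apply/negP; rewrite -ltNge ltr_norml.
by apply/andP; split; lra.
Qed.

End NonlineableNorm.

(** * Norm-attaining functionals *)

Section Planes.
Context {R : realType} {V : lmodType R}.
Implicit Types (f g h : V) (Z : set V).

Lemma linear_span_scale Z f a : Z f -> linear_span Z (a *: f).
Proof.
move=> Zf B [/linear_subspaceP[B0 BL] ZB].
by rewrite -[a *: f]addr0; apply: BL => //; exact: ZB.
Qed.

Lemma linearly_independent1 f : f != 0 -> linearly_independent [tuple f].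
Proof.
move=> f0 c; rewrite big_ord1 (tnth_nth 0)/= => /eqP.
by rewrite scaler_eq0 (negPf f0) orbF => /eqP c0 i; rewrite ord1.
Qed.

Lemma linearly_independent2 f g : linearly_independent [tuple f; g] <->
  forall a b, a *: f + b *: g = 0 -> a = 0 /\ b = 0.
Proof.
split=> [ind a b ab0|ind c].
  have := ind (fun i => if i == ord0 then a else b).
  rewrite big_ord_recl big_ord1 !(tnth_nth 0)/= => /(_ ab0) H.
  by split; [exact: (H ord0)|exact: (H (lift ord0 ord0))].
rewrite big_ord_recl big_ord1 !(tnth_nth 0)/= => /ind[c0 c1] i.
case: (unliftP ord0 i) => [j ->|->//].
by rewrite ord1.
Qed.

Lemma linear_span2 f g h : linear_span [set` [tuple f; g]] h ->
  exists a b, h = a *: f + b *: g.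
Proof.
have : linear_span [set` [tuple f; g]] `<=`
    [set v | exists a b, v = a *: f + b *: g].
  apply: smallest_sub => [|v /=]; last first.
    rewrite !inE => /orP[] /eqP ->; [exists 1, 0|exists 0, 1].
      by rewrite scale1r scale0r addr0.
    by rewrite scale1r scale0r add0r.
  split; first by rewrite inE; exists 0, 0; rewrite !scale0r addr0.
  move=> c v w; rewrite !inE /= => -[a [b ->]] [a' [b' ->]].
  exists (c * a + a'), (c * b + b').
  by rewrite scalerDr !scalerA !scalerDl addrACA.
exact.
Qed.

Lemma scale_of_dependent f g : f != 0 ->
  ~ (forall a b, a *: f + b *: g = 0 -> a = 0 /\ b = 0) ->
  exists a, g = a *: f.
Proof.
move=> f0 dep; apply: contrapT => ng; apply: dep => a b ab0.
have [b0|b0] := eqVneq b 0.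
  split=> //; move/eqP: ab0; rewrite b0 scale0r addr0 scaler_eq0 (negPf f0) orbF.
  by move/eqP.
exfalso; apply: ng; exists (- (b^-1 * a)).
have : b^-1 *: (a *: f + b *: g) = 0 by rewrite ab0 scaler0.
rewrite scalerDr !scalerA mulVf// scale1r => /eqP; rewrite addrC addr_eq0 => /eqP ->.
by rewrite scaleNr.
Qed.

(** Cramer's rule: [D] is the determinant of [f], [g] in the generators [e1], [e2], and both
    [D *: e1] and [D *: e2] are combinations of [f] and [g]. *)
Lemma plane_basis Z f g h : subspace_of_dim 2 Z -> Z f -> Z g -> Z h ->
  (forall a b, a *: f + b *: g = 0 -> a = 0 /\ b = 0) ->
  exists a b, h = a *: f + b *: g.
Proof.
move=> [e _ ->]; case/tupleP: e => e1 e; case/tupleP: e => e2 e; rewrite tuple0.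
move=> /linear_span2[a [b fE]] /linear_span2[a' [b' gE]] /linear_span2[c [c' hE]].
move=> ind; pose D := a * b' - b * a'.
have E1 : b' *: f - b *: g = D *: e1.
  rewrite fE gE !scalerDr !scalerA opprD addrACA (mulrC b b') subrr.
  by rewrite -!scalerBl (mulrC b' a) addr0.
have E2 : - a' *: f + a *: g = D *: e2.
  rewrite fE gE !scalerDr !scalerA addrACA -!scalerDl.
  rewrite (_ : - a' * a + a * a' = 0) ?scale0r ?add0r; last by ring.
  by congr (_ *: _); rewrite /D; ring.
have D0 : D != 0.
  apply/eqP => D0; move: E1 E2; rewrite D0 !scale0r -scaleNr.
  move=> /ind[_ /eqP]; rewrite oppr_eq0 => /eqP b0 /ind[_ a0].
  have [] := ind 1 0; last by move/eqP; rewrite oner_eq0.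
  by rewrite fE a0 b0 !scale0r !addr0 scaler0.
exists ((c * b' - c' * a') / D), ((c' * a - c * b) / D).
apply: (scalerI D0); rewrite hE !scalerDr.
rewrite !(scalerA D) ![D * (_ / D)]mulrCA mulfV// !mulr1 ![D * _]mulrC -!scalerA.
rewrite -E1 -E2 !scalerDr !scalerN !scalerA addrACA -scalerDl -scaleNr -scalerDl.
by congr (_ *: _ + _ *: _); ring.
Qed.

End Planes.

Section Assembly.
Context {R : realType}.

Lemma dual_of_scalar {X : normedModType R} (f : {scalar X}) (M : R) :
  (forall x, `|f x| <= M * `|x|) -> exists F : dual X, forall x, F x = f x.
Proof.
move=> fM.
have fP : (f : X -> R^o) \in @continuous_linear R X.
  apply/asboolP; split; first exact: linearP.
  move=> x; apply/cvgrPdist_lt => eps eps0.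
  have M0 : 0 < `|M| + 1 by rewrite ltr_wpDl.
  apply/nbhs_normP; exists (eps / (`|M| + 1)); first exact: divr_gt0.
  move=> y /=; rewrite ltr_pdivlMr// => xy.
  have -> : f x - f y = f (x - y) by rewrite linearB.
  apply: le_lt_trans xy; apply: le_trans (fM _) _; rewrite mulrC ler_wpM2l//.
  by apply: le_trans (ler_norm M) _; rewrite lerDl.
by exists (Dual fP).
Qed.

(** The coordinates of l_infty are pulled back along the embedding, whose injectivity makes them
    separate points. *)
Lemma ell_infty_coordinates {X : normedModType R} (Y : set (ell_infty R)) :
  isomorphic [set: X] Y ->
  exists (phi : nat -> {scalar X}) (A : R),
    (forall n x, `|phi n x| <= A * `|x|) /\
    forall x, (forall n, phi n x = 0) -> x = 0.
Proof.
move=> [T [S [_ [TK _] TL Tcont _]]].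
have {}TK x : S (T x) = x by apply: TK; rewrite inE.
have {}TL a x y : T (a *: x + y) = a *: T x + T y by apply: TL; rewrite inE.
have [A A0 TA] := @within_continuous_linear_bounded _ _ _ setT T I
  (fun _ _ _ _ _ => I) (fun a x y _ _ => TL a x y) Tcont.
have sc n : scalar (fun x => T x n : R) by move=> a x y; rewrite TL.
pose phi n : {scalar X} :=
  HB.pack (fun x => T x n : R) (GRing.isLinear.Build R X R *%R _ (sc n)).
exists phi, A; split=> [n x|x x0].
  by apply: le_trans (TA x I); exact: ell_infty_norm_ub.
have T0 : T 0 = 0 by have := TL (-1) 0 0; rewrite !scaleN1r !addNr.
rewrite -(TK x) -(TK 0) T0; congr S; apply/val_inj/funext => n; exact: x0.
Qed.

Lemma supportsN {V : lmodType R} (p : norm_on V) (f : {scalar V}) x :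
  supports p f x -> supports p (\- f) (- x).
Proof.
move=> [fp fx]; split=> [y|]; last by rewrite /= linearN opprK norm_onN.
by rewrite /= -linearN -(norm_onN p y).
Qed.

Lemma supports_scale {V : lmodType R} (p : norm_on V) (f : {scalar V}) a x :
  0 < a -> supports p f (a *: x) -> supports p f x.
Proof.
move=> a0 [fp]; rewrite linearZ/= norm_onZ gtr0_norm// => /(mulfI (lt0r_neq0 a0)).
by split.
Qed.

Lemma nonlineable_renorming (X : completeNormedModType R) :
  weakly_compactly_generated X ->
  (exists Y : set (ell_infty R),
     [/\ linear_subspace Y, closed Y & isomorphic [set: X] Y]) ->
  (exists Y : set X, linear_subspace Y /\ isomorphic (c0 R) Y) ->
  exists p : norm_on X, equivalent_norm p /\
    forall (f1 f2 f3 : {scalar X}) x1 x2 x3 (s1 s2 s3 : R),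
      x1 != 0 -> x2 != 0 -> x3 != 0 ->
      supports p f1 x1 -> supports p f2 x2 -> supports p f3 x3 ->
      0 < s1 -> 0 < s2 -> 0 < s3 ->
      (forall y, s3 * f3 y = s1 * f1 y + s2 * f2 y) ->
      exists2 l, l != 0 & forall y, f1 y = l * f2 y.
Proof.
move=> wcg [Y [_ _ Yiso]] [Z [Zlin Ziso]].
have [phi [A [phi_le phi_sep]]] := ell_infty_coordinates Yiso.
have /choice[Phi PhiE] n := dual_of_scalar (phi_le n).
have [|d d_total] := @total_sequence _ _ Phi _ wcg.
  by move=> x x0; apply: phi_sep => n; rewrite -PhiE.
have [e [psi [K [[K0 psi_le] psie e_sum [mu mueq mu_flat]]]]] :=
  c0_copy_flat_norm Zlin Ziso.
have [q [c [C [c0 C0 qE]]] [q_tangent q_smooth]] := smooth_norm_directions d mueq.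
have [u [u_le u_dir]] := direction_sequence phi_le phi_sep.
(* A common bound for [psi] and [u] relative to [q], obtained from [c * |x| <= q x]. *)
pose K' := (`|A| + K) / c.
have K'0 : 0 < K' by rewrite divr_gt0// ltr_wpDl.
have norm_q B x : B <= `|A| + K -> B * `|x| <= K' * q x.
  move=> BK; apply: le_trans (ler_wpM2r (normr_ge0 x) BK) _.
  rewrite /K' mulrAC ler_pdivlMr// -mulrA ler_wpM2l//.
    by rewrite addr_ge0// ltW.
  by rewrite mulrC; case/andP: (qE x).
have psi_q n x : `|psi n x| <= K' * q x.
  by apply: le_trans (psi_le n x) _; apply: norm_q; rewrite lerDr.
have u_q n x : `|u n x| <= K' * q x.
  apply: le_trans (u_le n x) _; apply: norm_q.
  by rewrite (le_trans (ler_norm A))// lerDl ltW.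
have u_sum n M := e_sum (u n) A (u_le n) M.
have q_flat x : exists n0 c E, 0 < c /\ forall n s, (n0 <= n)%N ->
    `|s| <= c -> q (x + s *: e n) ^+ 2 - q x ^+ 2 <= E * s ^+ 2.
  have [y hy] := q_tangent x; have [n0 [b [b0 hb]]] := mu_flat y.
  exists n0, b, 1; split=> // n s n0n sb.
  by have := hy (s *: e n); have := hb n s n0n sb; lra.
have [p [M [[M0 pE] p_smooth p_main]]] :=
  nonlineable_norm K'0 psi_q u_q psie u_sum u_dir q_flat q_smooth.
have p_le x : p x <= M * C * `|x|.
  have /andP[_ /le_trans] := pE x; apply; rewrite -mulrA ler_pM2l//.
  by case/andP: (qE x).
exists p; split.
  exists c, (M * C); split; rewrite ?mulr_gt0// => x; rewrite p_le andbT.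
  by case/andP: (qE x) => /le_trans + _; apply; case/andP: (pE x).
(* Smoothness along the total sequence [d] suffices: the difference of two support functionals at
   [x] is continuous and vanishes on [d]. *)
have supports_uniq (f1 f2 : {scalar X}) x : x != 0 ->
    supports p f1 x -> supports p f2 x -> forall y, f1 y = f2 y.
  move=> x0 sf1 sf2 y.
  pose g : {scalar X} := f1 \- f2.
  have f_le (f : {scalar X}) z : supports p f x -> `|f z| <= M * C * `|z|.
    move=> [fp _]; apply: le_trans (p_le z).
    by rewrite ler_norml fp andbT lerNl -linearN -(norm_onN p z) fp.
  have [|G GE] := @dual_of_scalar _ g (M * C + M * C).
    move=> z; rewrite /g/= mulrDl (le_trans (ler_normB _ _))//.
    by rewrite lerD//; exact: f_le.
  have G0 : G = 0.
    by apply: d_total => i; rewrite GE /g/= (p_smooth _ _ _ x0 sf1 sf2) subrr.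
  by apply/eqP; rewrite -subr_eq0; have := GE y; rewrite G0 /g/= => <-.
move=> f1 f2 f3 x1 x2 x3 s1 s2 s3 x10 x20 x30 sf1 sf2 sf3 s10 s20 s30 fE.
have [l x2E] : exists l, x2 = l *: x1.
  by apply: scale_of_dependent => //; exact: (p_main f1 f2 f3 x1 x2 x3 s1 s2 s3).
have l0 : l != 0 by apply: contra_neq x20 => l0; rewrite x2E l0 scale0r.
(* According to the sign of [l], either [- f2] or [f2] supports [p] at [x1], and uniqueness compares
   it with [f1]. *)
rewrite x2E in sf2; case: (ltgtP l 0) => [lneg|lpos|/eqP]; last by rewrite (negPf l0).
- exists (-1); rewrite ?oppr_eq0 ?oner_eq0// => y.
  have nl : 0 < - l by rewrite oppr_gt0.
  have := supportsN sf2; rewrite -scaleNr => /(supports_scale nl) sf2'.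
  by rewrite (supports_uniq _ _ _ x10 sf1 sf2') mulN1r.
- exists 1; rewrite ?oner_eq0// => y; rewrite mul1r.
  exact: (supports_uniq _ _ _ x10 sf1 (supports_scale lpos sf2)).
Qed.

End Assembly.

(** * From support functionals to norm-attaining functionals *)

Section NormAttaining.
Context {R : realType} {X : lmodType R} (p : norm_on X).
Implicit Types f g h : dual (renormed p).

Lemma norm_attainingZ a f : norm_attaining _ f -> norm_attaining _ (a *: f).
Proof.
move=> [x x1 fx]; exists x => //.
by rewrite [RHS]normrZ -fx -normrM.
Qed.

Lemma dual_le f (y : renormed p) : `|f y| <= `|f| * p y.
Proof.
have [->|y0] := eqVneq y 0; first by rewrite dual0 normr0 norm_on0 mulr0.
have py : 0 < p y by exact: norm_on_gt0.
have := @dual_norm_ub _ _ f ((p y)^-1 *: y).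
have -> : `|(p y)^-1 *: y| = 1 :> R.
  by rewrite normrZ normfV (gtr0_norm py) mulVf// gt_eqF.
by rewrite dualZ normrM normfV (gtr0_norm py) mulrC ler_pdivrMr// => /(_ (lexx _)).
Qed.

(** Divide [f] by its norm, and replace the point of attainment by its opposite if the value there
    is negative. *)
Lemma norm_attaining_supports f : f != 0 -> norm_attaining _ f ->
  exists (g : {scalar X}) (x : X) (r : R),
    [/\ 0 < r, x != 0, supports p g x & forall y, f y = r * g y].
Proof.
move=> f0 [x0 x01 fx0].
have r0 : 0 < `|f| by rewrite normr_gt0.
have sc : scalar (fun y : X => `|f|^-1 * f y : R).
  by move=> a y z; rewrite (dual_linear f a y z) mulrDr mulrCA.
pose g : {scalar X} :=
  HB.pack (fun y : X => `|f|^-1 * f y : R) (GRing.isLinear.Build R X R *%R _ sc).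
have gp y : g y <= p y.
  rewrite /g/= ler_pdivrMl// (le_trans (ler_norm _))//; exact: dual_le.
have fg y : f y = `|f| * g y by rewrite /g/= mulrA mulfV ?mul1r// gt_eqF.
have px0 : p x0 = 1 by exact: x01.
have x0n0 : x0 != 0 :> X.
  by apply/eqP => x00; move/eqP: px0; rewrite x00 norm_on0 eq_sym oner_eq0.
have gx0 : `|g x0| = 1.
  by rewrite /g/= normrM normfV normr_id fx0 mulVf// gt_eqF.
exists g; have [gpos|gneg] := leP 0 (g x0).
  exists x0, `|f|; split=> //; split=> //.
  by rewrite px0 -gx0 ger0_norm.
exists (- x0), `|f|; split=> //; first by rewrite oppr_eq0.
by split=> //; rewrite linearN norm_onN px0 -gx0 ltr0_norm.
Qed.

Context (p_nonlineable : forall (f1 f2 f3 : {scalar X}) x1 x2 x3 (s1 s2 s3 : R),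
  x1 != 0 -> x2 != 0 -> x3 != 0 ->
  supports p f1 x1 -> supports p f2 x2 -> supports p f3 x3 ->
  0 < s1 -> 0 < s2 -> 0 < s3 ->
  (forall y, s3 * f3 y = s1 * f1 y + s2 * f2 y) ->
  exists2 l, l != 0 & forall y, f1 y = l * f2 y).

(** After normalization, the convex combination is a relation with positive coefficients between
    three support functionals. It forces the first two to be proportional, against the independence
    of [f] and [g]. *)
Lemma norm_attaining_segment f g t : norm_attaining _ f -> norm_attaining _ g ->
  (forall a b, a *: f + b *: g = 0 -> a = 0 /\ b = 0) -> 0 < t < 1 ->
  ~ norm_attaining _ (t *: f + (1 - t) *: g).
Proof.
move=> fNA gNA ind /andP[t0 t1] hNA.
have f0 : f != 0.
  apply/eqP => f0; have [|/eqP] := ind 1 0; last by rewrite oner_eq0.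
  by rewrite f0 scaler0 scale0r addr0.
have g0 : g != 0.
  apply/eqP => g0; have [|_ /eqP] := ind 0 1; last by rewrite oner_eq0.
  by rewrite g0 scaler0 scale0r addr0.
have h0 : t *: f + (1 - t) *: g != 0.
  by apply/eqP => /ind[/eqP]; rewrite gt_eqF.
have [f1 [x1 [r1 [r10 x10 s1 E1]]]] := norm_attaining_supports f0 fNA.
have [f2 [x2 [r2 [r20 x20 s2 E2]]]] := norm_attaining_supports g0 gNA.
have [f3 [x3 [r3 [r30 x30 s3 E3]]]] := norm_attaining_supports h0 hNA.
have [||l l0 lE] :=
  @p_nonlineable f1 f2 f3 x1 x2 x3 (t * r1) ((1 - t) * r2) r3 x10 x20 x30 s1 s2 s3
    (mulr_gt0 t0 r10) _ r30.
- by rewrite mulr_gt0// subr_gt0.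
- by move=> y; rewrite -E3 -!mulrA -E1 -E2.
have : r2 *: f + (- (r1 * l)) *: g = 0.
  apply/val_inj/funext => y.
  have -> : \val (r2 *: f + (- (r1 * l)) *: g) y = r2 * f y - r1 * l * g y.
    by rewrite -[in RHS]mulNr.
  by rewrite E1 E2 lE (_ : \val (0 : dual (renormed p)) y = 0) //; ring.
by move=> /ind[/eqP]; rewrite gt_eqF.
Qed.

(** If both coefficients are nonzero, absorbing their signs into [f] and [g] and dividing by
    [|a| + |b|] gives an interior point of a segment. *)
Lemma norm_attaining_comb f g a b : norm_attaining _ f -> norm_attaining _ g ->
  (forall a b, a *: f + b *: g = 0 -> a = 0 /\ b = 0) ->
  norm_attaining _ (a *: f + b *: g) -> a = 0 \/ b = 0.
Proof.
move=> fNA gNA ind hNA.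
have [a0|a0] := eqVneq a 0; [by left|right].
apply/eqP/negPn/negP => b0.
have na : 0 < `|a| by rewrite normr_gt0.
have nb : 0 < `|b| by rewrite normr_gt0.
have w0 : `|a| + `|b| != 0 by rewrite gt_eqF// addr_gt0.
have sa : Num.sg a != 0 by rewrite sgr_eq0.
have sb : Num.sg b != 0 by rewrite sgr_eq0.
pose t := `|a| / (`|a| + `|b|).
have t01 : 0 < t < 1.
  by rewrite divr_gt0 ?addr_gt0//= ltr_pdivrMr ?addr_gt0// mul1r ltrDl.
have ind' c c' : c *: (Num.sg a *: f) + c' *: (Num.sg b *: g) = 0 -> c = 0 /\ c' = 0.
  rewrite !scalerA => /ind[/eqP + /eqP]; rewrite !mulf_eq0 (negPf sa) (negPf sb).
  by rewrite !orbF => /eqP -> /eqP ->.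
have := norm_attaining_segment (norm_attainingZ (Num.sg a) fNA)
  (norm_attainingZ (Num.sg b) gNA) ind' t01; apply.
have := norm_attainingZ (`|a| + `|b|)^-1 hNA.
rewrite !scalerDr !scalerA.
have -> : (`|a| + `|b|)^-1 * a = t * Num.sg a.
  by rewrite [X in _ * X](numEsg a) /t; ring.
have -> // : (`|a| + `|b|)^-1 * b = (1 - t) * Num.sg b.
have -> : 1 - t = `|b| / (`|a| + `|b|) by rewrite /t; field.
by rewrite [X in _ * X](numEsg b); ring.
Qed.

Lemma norm_attaining_plane (Z : set (dual (renormed p))) : subspace_of_dim 2 Z ->
  exists f g, [/\ f != 0, g != 0 & forall h, Z h -> norm_attaining _ h ->
    exists a, h = a *: f \/ h = a *: g].
Proof.
move=> Zdim.
have [[f [g [[Zf fNA] [Zg gNA] ind]]]|nind] := pselect (exists f g,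
  [/\ Z f /\ norm_attaining _ f, Z g /\ norm_attaining _ g &
      forall a b, a *: f + b *: g = 0 -> a = 0 /\ b = 0]).
  exists f, g; split.
  - apply/eqP => f0; have [|/eqP] := ind 1 0; last by rewrite oner_eq0.
    by rewrite f0 scaler0 scale0r addr0.
  - apply/eqP => g0; have [|_ /eqP] := ind 0 1; last by rewrite oner_eq0.
    by rewrite g0 scaler0 scale0r addr0.
  - move=> h Zh; have [a [b ->]] := plane_basis Zdim Zf Zg Zh ind.
    move=> /(norm_attaining_comb fNA gNA ind)[->|->].
      by exists b; right; rewrite scale0r add0r.
    by exists a; left; rewrite scale0r addr0.
have [[f [Zf fNA f0]]|n0] := pselect (exists f, [/\ Z f, norm_attaining _ f & f != 0]).
  exists f, f; split=> // h Zh hNA.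
  have [a ->] : exists a, h = a *: f.
    by apply: scale_of_dependent => // ind; apply: nind; exists f, h.
  by exists a; left.
(* Only 0 attains its norm in [Z], so any nonzero vector serves for both lines. *)
have [e eind _] := Zdim.
exists (tnth e ord0), (tnth e ord0).
have e0 : tnth e ord0 != 0.
  apply/eqP => e0.
  have := eind (fun i => if i == ord0 then 1 else 0).
  rewrite big_ord_recl big_ord1 /= e0 scaler0 scale0r addr0 => /(_ erefl ord0)/eqP.
  by rewrite oner_eq0.
split=> // h Zh hNA; exists 0; left; rewrite scale0r.
by apply/eqP/negPn/negP => h0; apply: n0; exists h.
Qed.

End NormAttaining.

Theorem proposition4 (R : realType) (X : completeNormedModType R)
    (X_wcg : weakly_compactly_generated X)
    (X_sub_ell_infty : exists Y : set (ell_infty R),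
      [/\ linear_subspace Y, closed Y & isomorphic [set: X] Y])
    (c0_sub_X : exists Y : set X, linear_subspace Y /\ isomorphic (c0 R) Y) :
  exists p : norm_on X, equivalent_norm p /\
    [/\ forall Z : set (dual (renormed p)), subspace_of_dim 2 Z ->
          exists L1 L2 : set (dual (renormed p)),
            [/\ subspace_of_dim 1 L1, subspace_of_dim 1 L2 &
                Z `&` norm_attaining (renormed p) `<=` L1 `|` L2],
        forall Z : set (dual (renormed p)), subspace_of_dim 2 Z ->
          (Z `&` unit_sphere) `&` norm_attaining (renormed p) #<= `I_4 &
        forall f g : dual (renormed p),
          norm_attaining (renormed p) f -> norm_attaining (renormed p) g ->
          linearly_independent [tuple f; g] ->
          forall t : R, 0 < t < 1 ->
            ~ norm_attaining (renormed p) (t *: f + (1 - t) *: g)].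
Proof.
have [p [p_eq p_nl]] := nonlineable_renorming X_wcg X_sub_ell_infty c0_sub_X.
exists p; split=> //; split.
- move=> Z /(norm_attaining_plane p_nl)[f [g [f0 g0 Zfg]]].
  exists (linear_span [set` [tuple f]]), (linear_span [set` [tuple g]]).
  split; [by exists [tuple f]; first exact: linearly_independent1
         |by exists [tuple g]; first exact: linearly_independent1|].
  move=> h [Zh hNA]; have [a [->|->]] := Zfg h Zh hNA; [left|right];
    by apply: linear_span_scale; rewrite /= inE.
- move=> Z /(norm_attaining_plane p_nl)[f [g [f0 g0 Zfg]]].
  (* Each of the two lines meets the unit sphere in two opposite points; [s] enumerates these four
     points on [I_4]. *)
  pose s (k : nat) := nth 0 [:: `|f|^-1 *: f; - `|f|^-1 *: f;
    `|g|^-1 *: g; - `|g|^-1 *: g] k.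
  apply: card_le_trans (card_image_le s `I_4); apply: subset_card_le.
  have unit (v : dual (renormed p)) a : v != 0 -> `|a *: v| = 1 ->
      a = `|v|^-1 \/ a = - `|v|^-1.
    move=> v0 av1; have nv : `|v| != 0 by rewrite normr_eq0.
    have : `|a| = `|v|^-1 by apply: (mulIf nv); rewrite -normrZ av1 mulVf.
    by case: (ger0P a) => _ av; [left|right; rewrite -av opprK].
  move=> h [[Zh h1] hNA]; have [a [hE|hE]] := Zfg h Zh hNA; rewrite hE in h1 *;
    [have [->|->] := unit f a f0 h1|have [->|->] := unit g a g0 h1].
  + by exists 0%N.
  + by exists 1%N.
  + by exists 2%N.
  + by exists 3%N.
- move=> f g fNA gNA /linearly_independent2 ind t t01.
  exact: (norm_attaining_segment p_nl fNA gNA ind t01).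
Qed.
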